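(* Fix a distance $d\in\{d_{TV},d_H,W_1\}$, a problem type (IP, SE or PS), data $y_1,\dots,y_k$ with $k\ge2$, and suppose that at every step $i\le k$ the assumptions listed below for that problem type and distance hold (with $y_i$, step $i$). Let $P_0$ be the initial prior, $P_i=F_i(P_{i-1})$ the exact posteriors, $Q_1,Q_2,\dots$ arbitrary approximate posteriors, $Q_1^*=F_1(P_0)$ and $Q_i^*=F_i(Q_{i-1})$ for $i\ge2$. Assume $P_i\in\bar{\mathcal{P}}_{i+1}(\bar{\mathcal{X}})$ for all $i\in[0,k-1]$ and $Q_i\in\bar{\mathcal{P}}_{i+1}(\bar{\mathcal{X}})$ for all $i\in[1,k-1]$. Then $$d(P_k,Q_k)\le\sum_{j=1}^{k-1}C_j\, d(Q_j^*,Q_j)+d(Q_k^*,Q_k)\quad\text{and}\quad d(P_k,Q_k)\le\sum_{j=1}^{k-1}C'_j\, d(Q_j^*,Q_j)+d(Q_k^*,Q_k),$$ where, writing $p_{j,k}:=p(\mathcal{Y}_{j+1:k}\mid\mathcal{Y}_{1:j})$ and $z_{j,k}:=\prod_{i=j+1}^kZ_i(Q_{i-1})$: - $d_{TV}$: $C_j=\frac{\prod_{i=j+1}^k c_i}{p_{j,k}}$, $C'_j=\frac{\prod_{i=j+1}^k c_i}{z_{j,k}}$, with $c_i=C_h(y_i)$ (IP), $C_{Th}(y_i;i)$ (SE), $\tilde C_{Th}(y_i;i)$ (PS); - $d_H$: $C_j=\frac{2^{k-j}\prod_{i=j+1}^k\sqrt{c_i}}{\sqrt{p_{j,k}}}$,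 $C'_j=\frac{2^{k-j}\prod_{i=j+1}^k\sqrt{c_i}}{\sqrt{z_{j,k}}}$ with the same $c_i$; - $W_1$: $C_j=\frac{\prod_{i=j+1}^k e_i}{p_{j,k}}$, $C'_j=\frac{\prod_{i=j+1}^k e_i}{z_{j,k}}$, with $e_i=2D\|h\|_{\mathrm{Lip}}(y_i)+C_h(y_i)$ (IP), $e_i=2DC^*_{Th}(y_i;i)$ (SE), $e_i=2D\tilde C^*_{Th}(y_i;i)+\tilde C_{Th}(y_i;i)$ (PS). Required assumptions at each step $i$: IP: (IP.1) for $d_{TV},d_H$; (IP.1),(IP.2),(B) for $W_1$. SE: (SE.1) for $d_{TV},d_H$; (SE.2),(B) for $W_1$. PS: (PS.1) for $d_{TV},d_H$; (PS.1),(PS.2),(PS.3),(B) for $W_1$.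
   Context: Spaces: $(\mathcal{X},d_{\mathcal{X}})$ is a Polish metric space and, in parameter-state estimation, $(\mathcal{X}\times\mathcal{W},d_{\mathcal{X}\times\mathcal{W}})$ is a Polish metric space; $dx$, $dw$ denote Lebesgue measure, $\lambda$ is Lebesgue measure on $\mathcal{X}\times\mathcal{W}$. $\bar{\mathcal{X}}=\mathcal{X}$ (IP, SE) or $\mathcal{X}\times\mathcal{W}$ (PS); $\mathcal{P}(\bar{\mathcal{X}})$ denotes Borel probability measures. Problems at step $i$ with datum $y_i$. IP: measurable likelihood $h(y_i,x)\ge0$, $\tilde F_i\mu(dx)=h(y_i,x)\mu(dx)$. SE: Markov model with transition density $T_i(x_i,x_{i-1})$ (density in $x_i$) and observation density $h_i(y_i,x_i)$; $\tilde F_i\mu(dx)=h_i(y_i,x)(\int T_i(x,x')\mu(dx'))dx$. PS: $T_i(x_i,x_{i-1},w)$, $h_i(y_i,x_i,w)$; for $\mu\ll\lambda$ with density $\pi$, $\tilde F_i\mu(dx,dw)=h_i(y_i,x,w)(\int T_i(x,x',w)\pi(x',w)dx')dxdw$. Evidence $Z_i(\mu)=\tilde F_i\mu(\bar{\mathcal{X}})$, posterior $F_i\mu=\tilde F_i\mu/Z_i(\mu)$. Admissible priors $\bar{\mathcal{P}}_i(\bar{\mathcal{X}})$: IP: $0<Z_i(\mu)<\infty$; SE: $\int T_i(x_i,x')\mu(dx')<\infty$ for all $x_i$ and $0<Z_i(\mu)<\infty$; PS: $\mu\ll\lambda$, $\int T_i(x_i,x',w)\frac{d\mu}{d\lambda}(x',w)dx'<\infty$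 for all $x_i,w$ and $0<Z_i(\mu)<\infty$. The data predictive density is $p(\mathcal{Y}_{j+1:k}\mid\mathcal{Y}_{1:j})=\prod_{i=j+1}^k p(y_i\mid\mathcal{Y}_{1:i-1})$ with $p(y_i\mid\mathcal{Y}_{1:i-1})=Z_i(P_{i-1})$. Distances: $d_{TV}(\mu,\mu')=\frac12\int|\frac{d\mu}{d\nu}-\frac{d\mu'}{d\nu}|d\nu$, $d_H(\mu,\mu')=\sqrt{\frac12\int(\sqrt{d\mu/d\nu}-\sqrt{d\mu'/d\nu})^2d\nu}$ ($\nu$ dominating both), $W_1$ the 1-Wasserstein distance w.r.t. the metric on $\bar{\mathcal{X}}$. Assumptions at step $i$: (IP.1) $C_h(y_i)=\sup_xh(y_i,x)<\infty$. (IP.2) $x\mapsto h(y_i,x)$ globally Lipschitz with best constant $\|h\|_{\mathrm{Lip}}(y_i)$. (SE.1) $C_{Th}(y_i;i)=\sup_{x'}\int h_i(y_i,x)T_i(x,x')dx<\infty$. (SE.2) $T_{\mathrm{Lip}}(x_i;i)=\sup_{x\neq x'}|T_i(x_i,x)-T_i(x_i,x')|/d_{\mathcal{X}}(x,x')<\infty$ for all $x_i$ and $C^*_{Th}(y_i;i)=\int h_i(y_i,x_i)T_{\mathrm{Lip}}(x_i;i)dx_i<\infty$. (PS.1) $\tilde C_{Th}(y_i;i)=\sup_{x',w}\int h_i(y_i,x,w)T_i(x,x',w)dx<\infty$. (PS.2) with $\tilde f_i(y_i,x_i,x,w)=h_i(y_i,x_i,w)T_i(x_i,x,w)$, $\tilde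 f_{\mathrm{Lip}}(x_i;i)=\sup_{(x,w)\ne(x',w')}|\tilde f_i(y_i,x_i,x,w)-\tilde f_i(y_i,x_i,x',w')|/d_{\mathcal{X}\times\mathcal{W}}((x,w),(x',w'))<\infty$ for all $x_i$ and $\tilde C^*_{Th}(y_i;i)=\int\tilde f_{\mathrm{Lip}}(x_i;i)dx_i<\infty$. (PS.3) $d_{\mathcal{X}\times\mathcal{W}}((x,w),(x,w'))\le d_{\mathcal{X}\times\mathcal{W}}((\tilde x,w),(x',w'))$ for all $x,\tilde x,x',w,w'$. (B) $D=\sup d_{\bar{\mathcal{X}}}(\bar x,\bar x')<\infty$. *)

(* Defs.v *)
From HB Require Import structures.
From mathcomp Require Import all_boot all_order all_algebra.
From mathcomp Require Import all_classical all_reals all_analysis.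
Set Implicit Arguments. Unset Strict Implicit. Unset Printing Implicit Defensive.
Import Order.TTheory GRing.Theory Num.Theory.
Local Open Scope classical_set_scope.
Local Open Scope ring_scope.

Section metric.
Context {R : realType} {d : measure_display} {T : measurableType d}.
Variable dist : T -> T -> R.

Definition is_metric :=
  [/\ (forall x y, 0 <= dist x y), (forall x y, dist x y = 0 <-> x = y),
      (forall x y, dist x y = dist y x) &
      (forall x y z, dist x z <= dist x y + dist y z)].

Definition dball (x : T) (r : R) := [set y | dist x y < r].

Definition dopen (A : set T) :=
  forall x, A x -> exists2 r : R, 0 < r & dball x r `<=` A.

Definition dseparable :=
  exists s : nat -> T, forall x (e : R), 0 < e -> exists n, dist x (s n) < e.

Definition dcomplete :=
  forall u : nat -> T,
    (forall e : R, 0 < e -> exists N, forall m n, (N <= m)%N -> (N <= n)%N ->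
        dist (u m) (u n) < e) ->
    exists x, forall e : R, 0 < e -> exists N, forall n, (N <= n)%N ->
        dist (u n) x < e.

Definition borel_of_metric := @measurable d T = <<s dopen >>.

Definition polish := [/\ is_metric, dseparable, dcomplete & borel_of_metric].

Definition diam : \bar R := ereal_sup [set (dist x x')%:E | x in setT & x' in setT].

End metric.

Section distances.
Context {R : realType} {d : measure_display} {T : measurableType d}.

Definition is_density (nu mu : set T -> \bar R) (f : T -> R) :=
  [/\ measurable_fun setT f, (forall x, 0 <= f x) &
      forall A, measurable A -> mu A = (\int[nu]_(x in A) (f x)%:E)%E].

(* d_TV(mu,mu') = 1/2 int |dmu/dnu - dmu'/dnu| dnu, nu dominating both;
   the value does not depend on the dominating measure nu, so we take the
   infimum over all choices (all give the same value). *)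
Definition d_TV (mu mu' : set T -> \bar R) : \bar R :=
  ereal_inf [set r | exists (nu : {measure set T -> \bar R}) (f g : T -> R),
    [/\ is_density nu mu f, is_density nu mu' g &
        r = ((2^-1)%:E * \int[nu]_x (`|f x - g x|)%:E)%E]].

Definition d_H (mu mu' : set T -> \bar R) : \bar R :=
  ereal_inf [set r | exists (nu : {measure set T -> \bar R}) (f g : T -> R),
    [/\ is_density nu mu f, is_density nu mu' g &
        r = (Num.sqrt (2^-1 *
               fine (\int[nu]_x ((Num.sqrt (f x) - Num.sqrt (g x)) ^+ 2)%:E)))%:E]].

Definition coupling (mu mu' : set T -> \bar R) (pi : set (T * T) -> \bar R) :=
  forall A, measurable A -> pi (A `*` setT) = mu A /\ pi (setT `*` A) = mu' A.

Definition d_W1 (dist : T -> T -> R) (mu mu' : set T -> \bar R) : \bar R :=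
  ereal_inf [set (\int[pi]_z (dist z.1 z.2)%:E)%E |
     pi in [set pi : probability (T * T)%type R | coupling mu mu' pi]].

End distances.

Inductive distance := dTV | dHel | dW1.

Section generic.
Context {R : realType} {d : measure_display} {T : measurableType d}.
Implicit Types (mu : set T -> \bar R).

Definition Zev (Ft : (set T -> \bar R) -> set T -> \bar R) mu : \bar R := Ft mu setT.

Definition post (Ft : (set T -> \bar R) -> set T -> \bar R) mu : set T -> \bar R :=
  fun A => (Ft mu A * ((fine (Zev Ft mu))^-1)%:E)%E.

Variable Ft : nat -> (set T -> \bar R) -> set T -> \bar R.

Fixpoint exactP (P0 : set T -> \bar R) (n : nat) : set T -> \bar R :=
  match n with
  | O => P0
  | S n' => post (Ft n) (exactP P0 n')
  end.

Definition Qstar (P0 : set T -> \bar R) (Q : nat -> set T -> \bar R) (j : nat) :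
  set T -> \bar R :=
  match j with
  | O => P0 (* unused *)
  | S O => post (Ft 1) P0
  | S j' => post (Ft j) (Q j')
  end.

(* p(Y_{j+1:k} | Y_{1:j}) = prod_{i=j+1}^k Z_i(P_{i-1}) *)
Definition pred_dens (P0 : set T -> \bar R) (j k : nat) : R :=
  \prod_(j.+1 <= i < k.+1) fine (Zev (Ft i) (exactP P0 i.-1)).

Definition zprod (Q : nat -> set T -> \bar R) (j k : nat) : R :=
  \prod_(j.+1 <= i < k.+1) fine (Zev (Ft i) (Q i.-1)).

Definition dist_of (dist : T -> T -> R) (dk : distance) :
  (set T -> \bar R) -> (set T -> \bar R) -> \bar R :=
  match dk with dTV => d_TV | dHel => d_H | dW1 => d_W1 dist end.

(* constants C_j (norm = p_{j,k}) and C'_j (norm = z_{j,k}); cst i is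
   c_i for d_TV, d_H and e_i for W_1 *)
Definition coef (dk : distance) (cst : nat -> R) (norm : R) (j k : nat) : R :=
  match dk with
  | dHel => 2 ^+ (k - j) * (\prod_(j.+1 <= i < k.+1) Num.sqrt (cst i)) / Num.sqrt norm
  | _ => (\prod_(j.+1 <= i < k.+1) cst i) / norm
  end.

Definition stability_bounds (dist : T -> T -> R) (dk : distance)
  (P0 : set T -> \bar R) (Q : nat -> set T -> \bar R) (k : nat) (cst : nat -> R) :=
  let dd := dist_of dist dk in
  (dd (exactP P0 k) (Q k) <=
     \sum_(1 <= j < k) ((coef dk cst (pred_dens P0 j k) j k)%:E * dd (Qstar P0 Q j) (Q j))
     + dd (Qstar P0 Q k) (Q k))%E /\
  (dd (exactP P0 k) (Q k) <=
     \sum_(1 <= j < k) ((coef dk cst (zprod Q j k) j k)%:E * dd (Qstar P0 Q j) (Q j))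
     + dd (Qstar P0 Q k) (Q k))%E.

End generic.

Section IP.
Context {R : realType} {d : measure_display} {X : measurableType d} {Y : Type}.
Variables (h : Y -> X -> R) (y : nat -> Y).

Definition Ft_IP (i : nat) (mu : set X -> \bar R) : set X -> \bar R :=
  fun A => (\int[mu]_(x in A) (h (y i) x)%:E)%E.

Definition adm_IP (i : nat) (mu : set X -> \bar R) :=
  (0 < Zev (Ft_IP i) mu)%E /\ (Zev (Ft_IP i) mu < +oo)%E.

Definition C_h (i : nat) : \bar R := ereal_sup [set (h (y i) x)%:E | x in setT].

Definition h_Lip (dist : X -> X -> R) (i : nat) : \bar R :=
  ereal_sup [set r | exists x x', x <> x' /\
     r = (`|h (y i) x - h (y i) x'| / dist x x')%:E].

Definition IP_assum (dist : X -> X -> R) (dk : distance) (i : nat) : Prop :=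
  match dk with
  | dW1 => [/\ (C_h i < +oo)%E, (h_Lip dist i < +oo)%E & (diam dist < +oo)%E]
  | _ => (C_h i < +oo)%E
  end.

Definition IP_const (dist : X -> X -> R) (dk : distance) (i : nat) : R :=
  match dk with
  | dW1 => 2 * fine (diam dist) * fine (h_Lip dist i) + fine (C_h i)
  | _ => fine (C_h i)
  end.
End IP.

Section SE.
Context {R : realType} {d : measure_display} {X : measurableType d} {Y : Type}.
Variables (lam : set X -> \bar R) (T : nat -> X -> X -> R)
  (h : nat -> Y -> X -> R) (y : nat -> Y).

Definition Ft_SE (i : nat) (mu : set X -> \bar R) : set X -> \bar R :=
  fun A => (\int[lam]_(x in A) ((h i (y i) x)%:E * \int[mu]_x' (T i x x')%:E))%E.

Definition adm_SE (i : nat) (mu : set X -> \bar R) :=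
  [/\ (forall xi, \int[mu]_x' (T i xi x')%:E < +oo)%E,
      (0 < Zev (Ft_SE i) mu)%E & (Zev (Ft_SE i) mu < +oo)%E].

Definition C_Th (i : nat) : \bar R :=
  ereal_sup [set (\int[lam]_x (h i (y i) x * T i x x')%:E)%E | x' in setT].

Definition T_Lip (dist : X -> X -> R) (i : nat) (xi : X) : \bar R :=
  ereal_sup [set r | exists x x', x <> x' /\
     r = (`|T i xi x - T i xi x'| / dist x x')%:E].

Definition Cs_Th (dist : X -> X -> R) (i : nat) : \bar R :=
  (\int[lam]_xi ((h i (y i) xi)%:E * T_Lip dist i xi))%E.

Definition SE_assum (dist : X -> X -> R) (dk : distance) (i : nat) : Prop :=
  match dk with
  | dW1 => [/\ (forall xi, T_Lip dist i xi < +oo)%E, (Cs_Th dist i < +oo)%E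
            & (diam dist < +oo)%E]
  | _ => (C_Th i < +oo)%E
  end.

Definition SE_const (dist : X -> X -> R) (dk : distance) (i : nat) : R :=
  match dk with
  | dW1 => 2 * fine (diam dist) * fine (Cs_Th dist i)
  | _ => fine (C_Th i)
  end.
End SE.

Section PS.
Context {R : realType} {dx dw : measure_display}
  {X : measurableType dx} {W : measurableType dw} {Y : Type}.
Variables (lamX : set X -> \bar R) (lamW : set W -> \bar R)
  (T : nat -> X -> X -> W -> R) (h : nat -> Y -> X -> W -> R) (y : nat -> Y).

Definition lamXW : set (X * W) -> \bar R := (lamX \x lamW)%E.

Definition abs_cont (mu : set (X * W) -> \bar R) :=
  forall A, measurable A -> lamXW A = 0%E -> mu A = 0%E.

(* a version of the density d mu / d lambda (0 if none exists) *)
Definition dens (mu : set (X * W) -> \bar R) : X * W -> R :=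
  match pselect (exists f, is_density lamXW mu f) with
  | left e => proj1_sig (cid e)
  | right _ => fun _ => 0
  end.

Definition Ft_PS (i : nat) (mu : set (X * W) -> \bar R) : set (X * W) -> \bar R :=
  fun A => (\int[lamXW]_(z in A) ((h i (y i) z.1 z.2)%:E *
              \int[lamX]_x' (T i z.1 x' z.2 * dens mu (x', z.2))%:E))%E.

Definition adm_PS (i : nat) (mu : set (X * W) -> \bar R) :=
  [/\ abs_cont mu,
      (forall xi w, \int[lamX]_x' (T i xi x' w * dens mu (x', w))%:E < +oo)%E,
      (0 < Zev (Ft_PS i) mu)%E & (Zev (Ft_PS i) mu < +oo)%E].

Definition Ct_Th (i : nat) : \bar R :=
  ereal_sup [set r | exists x' w,
     r = (\int[lamX]_x (h i (y i) x w * T i x x' w)%:E)%E].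

Definition ft (i : nat) (xi : X) (z : X * W) : R := h i (y i) xi z.2 * T i xi z.1 z.2.

Definition ft_Lip (dist : X * W -> X * W -> R) (i : nat) (xi : X) : \bar R :=
  ereal_sup [set r | exists z z', z <> z' /\
     r = (`|ft i xi z - ft i xi z'| / dist z z')%:E].

Definition Cts_Th (dist : X * W -> X * W -> R) (i : nat) : \bar R :=
  (\int[lamX]_xi ft_Lip dist i xi)%E.

Definition PS3 (dist : X * W -> X * W -> R) :=
  forall x xt x' w w', dist (x, w) (x, w') <= dist (xt, w) (x', w').

Definition PS_assum (dist : X * W -> X * W -> R) (dk : distance) (i : nat) : Prop :=
  match dk with
  | dW1 => [/\ (Ct_Th i < +oo)%E,
              ((forall xi, ft_Lip dist i xi < +oo) /\ Cts_Th dist i < +oo)%E,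
              PS3 dist & (diam dist < +oo)%E]
  | _ => (Ct_Th i < +oo)%E
  end.

Definition PS_const (dist : X * W -> X * W -> R) (dk : distance) (i : nat) : R :=
  match dk with
  | dW1 => 2 * fine (diam dist) * fine (Cts_Th dist i) + fine (Ct_Th i)
  | _ => fine (Ct_Th i)
  end.
End PS.

(* Main.v *)
(* In all three problems the unnormalised update has the form
   F mu (A) = int_z int_u 1_A(Phi(u,z)) G(u,z) lam(du) mu(dz)
   (IP: u trivial, Phi = z, G = h(z); SE: Phi = u, G = h(u) T(u,z);
   PS: z = (x',w), Phi = (u,w), G = h(u,w) T(u,x',w)), so it suffices to show
   that one normalised update is Lipschitz and to chain by the triangle
   inequality, d(P_i,Q_i) <= d(F_i P_{i-1}, F_i Q_{i-1}) + d(Q_i*,Q_i).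
   Total variation: d_TV(P,Q) = max_A (P A - Q A), and
   int phi dP - int phi dQ <= c d_TV(P,Q) for 0 <= phi <= c.
   Hellinger: d_H^2 = 1 - int sqrt(p q), and int sqrt(p q) is the infimum of
   (int t dP + int t^-1 dQ) / 2 over t > 0, which makes it independent of the
   dominating measure and gives the data processing inequality.
   W_1: no duality is used.  The triangle inequality glues two couplings along
   the cells of a fine countable partition; a coupling pi of (P,Q) is pushed to
   one of (FP,FQ) by keeping the common part min(G(u,z),G(u,z')) and coupling
   the remainders independently, at a cost of at most D times their mass. *)

Require Import Defs.
From HB Require Import structures.
From mathcomp Require Import all_boot all_order all_algebra.
From mathcomp Require Import all_classical all_reals all_analysis.
From mathcomp Require Import measurable_realfun ring lra.
Import Order.TTheory GRing.Theory Num.Theory.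
Set Implicit Arguments. Unset Strict Implicit. Unset Printing Implicit Defensive.
Local Open Scope classical_set_scope.
Local Open Scope ring_scope.

(** * Integrals, densities and image measures *)

(** The two families of coefficients come from a single estimate: one update is Lipschitz with
    either evidence in the denominator. For total variation and [W_1] the larger evidence is reached
    at once; for Hellinger the roles of the two priors are exchanged. The argument gives slightly
    better constants than stated, [sqrt (2 c / Z)] for [2 sqrt c / sqrt Z] and [D] for [2 D] before
    the Lipschitz term. Exact gluing of couplings would require conditional laws given the middle
    point. Conditioning only on the cell that contains it leaves an explicit density, at the price
    of one cell diameter, which is arbitrarily small. As [W_1] is an infimum, exhibiting one
    coupling of the posteriors for each coupling of the priors is enough. Degenerate cases need
    care: on a one-point space the Lipschitz suprema range over an empty family and equal [-oo], so
    that even the sign of the constants has to be checked. *)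

Local Open Scope ereal_scope.

(* The posteriors of the statement are plain set functions, meaningful on
   measurable sets only. *)
Definition eqm {R : realType} {d} {T : measurableType d}
  (mu mu' : set T -> \bar R) := forall A, measurable A -> mu A = mu' A.

Section Integrals.
Context {R : realType} {d : measure_display} {T : measurableType d}.

Import HBNNSimple.

(** An integral evaluates its measure only at level sets of simple functions, and these are
    measurable. *)
Lemma eqm_integral (mu mu' : set T -> \bar R) D f : eqm mu mu' ->
  \int[mu]_(x in D) f x = \int[mu']_(x in D) f x.
Proof.
move=> e; rewrite /integral.
suff s (h : {nnsfun T >-> R}) : sintegral mu h = sintegral mu' h.
  by congr (ereal_sup _ - ereal_sup _); apply: eq_imagel => h _; exact: s.
by apply: eq_fsbigr => r _; rewrite e.
Qed.

Lemma eqm_is_density (nu mu mu' : set T -> \bar R) f : eqm mu mu' ->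
  is_density nu mu f -> is_density nu mu' f.
Proof. by move=> e [mf f0 h]; split=> // A mA; rewrite -e// h. Qed.

(** The integral of a nonnegative function is a supremum over the simple functions below it, hence
    monotone without any measurability. This is what the Lipschitz suprema under the integral sign
    require. *)
Lemma lower_integral_le (mu : {measure set T -> \bar R}) (f g : T -> \bar R) :
  (forall x, 0 <= f x) -> (forall x, f x <= g x) ->
  \int[mu]_x f x <= \int[mu]_x g x.
Proof.
move=> f0 fg; have g0 x : 0 <= g x by exact: le_trans (fg x).
rewrite !ge0_integralTE//; apply: le_ereal_sup => _ [h hf <-].
by exists h => // x; exact: le_trans (hf x) (fg x).
Qed.

Lemma density_integral (nu mu : {measure set T -> \bar R}) (f : T -> R)
    (g : T -> \bar R) : is_density nu mu f ->
  measurable_fun setT g -> (forall x, 0 <= g x) ->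
  \int[mu]_x g x = \int[nu]_x ((f x)%:E * g x).
Proof.
move=> [mf f0 fE] mg g0; under [RHS]eq_integral do rewrite muleC.
pose h := nnsfun_approx measurableT mg.
have -> : \int[mu]_x g x = lim (\int[mu]_x (EFin \o h n) x @[n --> \oo]).
  have gE x : g x = lim ((EFin \o h n) x @[n --> \oo]).
    by apply/esym/cvg_lim => //; exact: cvg_nnsfun_approx.
  under eq_integral => x _ do rewrite gE.
  apply: monotone_convergence => //.
  - by move=> n; apply/measurable_EFinP.
  - by move=> n x _ //=; rewrite lee_fin.
  - by move=> x _ a b ab; rewrite lee_fin; exact/lefP/nd_nnsfun_approx.
have -> : \int[nu]_x (g x * (f x)%:E) =
    lim (\int[nu]_x ((EFin \o h n) x * (f x)%:E) @[n --> \oo]).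
  have gE x : g x * (f x)%:E = lim (((EFin \o h n) x * (f x)%:E) @[n --> \oo]).
    apply/esym/cvg_lim => //; apply: cvgeZr => //; exact: cvg_nnsfun_approx.
  under eq_integral => x _ do rewrite gE.
  apply: monotone_convergence => //.
  - by move=> n; apply/emeasurable_funM; exact/measurable_EFinP.
  - by move=> n x _ /=; rewrite mule_ge0 ?lee_fin.
  - by move=> x _ a b ab/=; rewrite lee_wpmul2r ?lee_fin//; exact/lefP/nd_nnsfun_approx.
suff suf n : \int[mu]_x (EFin \o h n) x =
    \int[nu]_x ((EFin \o h n) x * (f x)%:E).
  by under eq_fun do rewrite suf.
rewrite integralT_nnsfun sintegralE.
transitivity (\int[nu]_x (\sum_(y \in range (h n))
    (y * \1_(h n @^-1` [set y]) x)%:E * (f x)%:E)); last first.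
  apply: eq_integral => x _ /=.
  rewrite -ge0_mule_fsuml => [|y]; last exact: nnfun_muleindic_ge0.
  by rewrite fsumEFin // -(fimfunE _ x).
rewrite ge0_integral_fsum//; last 2 first.
  - by move=> y; apply: emeasurable_funM => //; apply/measurable_EFinP => //;
      apply: measurable_funM.
  - by move=> m y _; rewrite mule_ge0 ?lee_fin// -lee_fin nnfun_muleindic_ge0.
apply: eq_fsbigr => r /set_mem[x0 _ rE].
under eq_integral do rewrite EFinM -muleA.
rewrite ge0_integralZl//; last 3 first.
- by apply: emeasurable_funM; exact/measurable_EFinP.
- by move=> x _; rewrite mule_ge0 ?lee_fin.
- by rewrite lee_fin -rE.
congr (_ * _); rewrite fE//.
rewrite [LHS]integral_mkcond; apply: eq_integral => x _.
by rewrite muleC epatch_indic.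
Qed.

Lemma exists_density_measure (nu : {measure set T -> \bar R}) (f : T -> R) :
  measurable_fun setT f -> (forall x, 0 <= f x)%R ->
  exists mu : {measure set T -> \bar R}, is_density nu mu f.
Proof.
move=> mf f0; pose m A := \int[nu]_(x in A) (f x)%:E.
have m0 : m set0 = 0 by rewrite /m integral_set0.
have m_ge0 A : 0 <= m A by apply: integral_ge0 => x _; rewrite lee_fin.
have m_sa : semi_sigma_additive m.
  move=> F mF tF mUF; rewrite /m ge0_integral_bigcup//.
  - apply: is_cvg_nneseries => n _ _; exact: m_ge0.
  - by apply/measurable_EFinP; exact: measurable_funTS.
  - by move=> x _; rewrite lee_fin.
pose M := isMeasure.Build _ _ _ m m0 m_ge0 m_sa.
pose mu : {measure set T -> \bar R} := HB.pack m M.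
by exists mu; split.
Qed.

Lemma exists_density (P : {finite_measure set T -> \bar R})
    (m : {sigma_finite_measure set T -> \bar R}) :
    (forall A, measurable A -> m A = 0 -> P A = 0) ->
  exists f, is_density m P f.
Proof.
move=> dom0; have dom : P `<< m.
  by move=> A nA B mB BA; apply: dom0 => //; exact: nA.
have [f [f0 fin intf fE]] := radon_nikodym_sigma_finite dom.
(* The Radon-Nikodym derivative is finite everywhere, so [fine] only changes its type. *)
exists (fine \o f); split.
- by apply: measurableT_comp => //; exact: measurable_int intf.
- by move=> x /=; rewrite fine_ge0.
- move=> A mA; rewrite fE ?inE//; apply: eq_integral => x _ /=.
  by rewrite fineK.
Qed.

End Integrals.

Section ProbabilityOfMass1.
Context {R : realType} {d : measure_display} {T : measurableType d}.
Variables (mu : {measure set T -> \bar R}) (mu1 : mu setT = 1).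

Let m (A : set T) := mu A.
Let m0 : m set0 = 0. Proof. exact: measure0. Qed.
Let m_ge0 A : 0 <= m A. Proof. exact: measure_ge0. Qed.
Let m_sa : semi_sigma_additive m. Proof. exact: measure_semi_sigma_additive. Qed.

#[local] HB.instance Definition _ := isMeasure.Build _ _ _ m m0 m_ge0 m_sa.
#[local] HB.instance Definition _ := Measure_isProbability.Build _ _ _ m mu1.

Lemma exists_probability : exists P : probability T R, eqm mu P.
Proof. by exists (m : probability T R). Qed.

End ProbabilityOfMass1.

Section Pushforward.
Context {R : realType} {d d' : measure_display}
  {T : measurableType d} {T' : measurableType d'}.

(** Source of the posteriors and of all nontrivial couplings below. The measure is described by its
    integrals rather than its values on sets, so that marginals and costs become Fubini
    computations. *)
Lemma exists_image_measure (nu : {measure set T -> \bar R}) (f : T -> R)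
    (psi : T -> T') : measurable_fun setT f -> (forall x, 0 <= f x)%R ->
    measurable_fun setT psi ->
  exists mu : {measure set T' -> \bar R}, forall g, measurable_fun setT g ->
    (forall x, 0 <= g x) -> \int[mu]_x g x = \int[nu]_x ((f x)%:E * g (psi x)).
Proof.
move=> mf f0 mpsi; have [mu0 h0] := exists_density_measure nu mf f0.
exists (pushforward mu0 psi) => g mg g0.
rewrite (ge0_integral_pushforward mpsi mu0 measurableT)// preimage_setT (density_integral h0)//.
- exact: measurableT_comp.
- by move=> x; exact: g0.
Unshelve. all: exact: mpsi. Qed.

Lemma integral_indicE (mu : {measure set T -> \bar R}) A : measurable A ->
  mu A = \int[mu]_x (\1_A x)%:E.
Proof. by move=> mA; rewrite integral_indic// setIT. Qed.

Lemma measurable_indicE (A : set T) : measurable A ->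
  measurable_fun setT (fun x => (\1_A x : R)%:E).
Proof. by move=> mA; apply/measurable_EFinP. Qed.

End Pushforward.

(** * Total variation *)

Section CommonDensity.
Context {R : realType} {d : measure_display} {T : measurableType d}.
Variables P Q S : probability T R.

Let m := measure_add (measure_add P Q) S.
Let mE A : m A = P A + Q A + S A.
Proof. by rewrite /m measure_addE; congr (_ + _); exact: measure_addE. Qed.
Let m_fin : fin_num_fun m.
Proof. by move=> A mA; rewrite mE !fin_numD !fin_num_measure. Qed.

#[local] HB.instance Definition _ := Measure.on m.
#[local] HB.instance Definition _ := Measure_isFinite.Build _ _ _ m m_fin.

(** The sum of the three measures dominates each of them. Three are needed for the Hellinger
    triangle inequality; elsewhere [Q] is passed twice. *)
Lemma exists_common_density : exists (nu : {measure set T -> \bar R}) f g h,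
  [/\ is_density nu P f, is_density nu Q g & is_density nu S h].
Proof.
have dom (P' : probability T R) : (forall A, P' A <= m A) ->
    exists f, is_density m P' f.
  move=> le; apply: exists_density => A mA mA0; apply/eqP.
  by rewrite eq_le measure_ge0 andbT -mA0 le.
have [f hf] : exists f, is_density m P f.
  by apply: dom => A; rewrite mE -addeA leeDl// adde_ge0.
have [g hg] : exists f, is_density m Q f.
  by apply: dom => A; rewrite mE addeAC leeDr// adde_ge0.
have [h hh] : exists f, is_density m S f.
  by apply: dom => A; rewrite mE leeDr// adde_ge0.
by exists m, f, g, h.
Qed.

End CommonDensity.

Section TotalVariation.
Context {R : realType} {d : measure_display} {T : measurableType d}.
Implicit Types (P Q S : probability T R) (nu : {measure set T -> \bar R}).

Lemma density_integral1 nu P f : is_density nu P f -> \int[nu]_x (f x)%:E = 1.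
Proof. by move=> [_ _ fE]; rewrite -fE// probability_setT. Qed.

(** Integrate the pointwise identity [|f - g| + f = 2 (f - g)^+ + g]. Both densities have mass 1,
    which is finite and cancels. *)
Lemma integral_pos_part nu P Q f g : is_density nu P f -> is_density nu Q g ->
  (2^-1)%:E * \int[nu]_x (`|f x - g x|)%:E =
  \int[nu]_x (Num.max (f x - g x) 0)%:E.
Proof.
move=> hf hg; have [mf f0 _] := hf; have [mg g0 _] := hg.
have mfg : measurable_fun setT (fun x => f x - g x)%R by exact: measurable_funB.
have mr : measurable_fun setT (fun x => Num.max (f x - g x) 0)%R.
  by apply: measurable_maxr.
have ma : measurable_fun setT (fun x => `|f x - g x|)%R by exact: measurableT_comp.
have r0 x : (0 <= Num.max (f x - g x) 0)%R by rewrite le_max lexx orbT.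
have E : \int[nu]_x (`|f x - g x|)%:E + 1 =
    2%:E * \int[nu]_x (Num.max (f x - g x) 0)%:E + 1.
  rewrite -{1}(density_integral1 hf) -{1}(density_integral1 hg).
  rewrite -ge0_integralZl//; last 2 first.
    exact/measurable_EFinP.
    by move=> x _; rewrite lee_fin.
  rewrite -!ge0_integralD//.
  - apply: eq_integral => x _; rewrite -EFinM -!EFinD; congr EFin.
    have [h|h] := leP (f x - g x)%R 0%R; first by rewrite ler0_norm//; ring.
    by rewrite gtr0_norm//; ring.
  - by move=> x _; rewrite -EFinM lee_fin mulr_ge0.
  - by apply/measurable_EFinP; exact: measurable_funM.
  - by move=> x _; rewrite lee_fin.
  - exact/measurable_EFinP.
  - exact/measurable_EFinP.
  - by move=> x _; rewrite lee_fin.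
  - exact/measurable_EFinP.
move: E => /(congr1 (fun z => z - 1)); rewrite !addeK// => ->.
by rewrite muleA -EFinM mulVf// mul1e.
Qed.

(** Pointwise, [f phi <= g phi + c (f - g)^+] whenever [0 <= phi <= c]. *)
Lemma integral_le_pos_part nu P Q f g phi (c : R) :
  is_density nu P f -> is_density nu Q g ->
  measurable_fun setT phi -> (forall x, 0 <= phi x <= c%:E) ->
  \int[P]_x phi x <= \int[Q]_x phi x +
    c%:E * \int[nu]_x (Num.max (f x - g x) 0)%:E.
Proof.
move=> hf hg mphi phi01; have [mf f0 _] := hf; have [mg g0 _] := hg.
have phi0 x : 0 <= phi x by have /andP[] := phi01 x.
have mfg : measurable_fun setT (fun x => f x - g x)%R by exact: measurable_funB.
have mr : measurable_fun setT (fun x => Num.max (f x - g x) 0)%R.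
  by apply: measurable_maxr.
have r0 x : (0 <= Num.max (f x - g x) 0)%R by rewrite le_max lexx orbT.
(* The sign of [c] is read off at a point of [T]; without points all the integrals vanish. *)
have [[x0 _]|/forallNP T0] := pselect (exists x : T, True); last first.
  rewrite (_ : \int[P]_x phi x = 0); last first.
    by apply: integral0_eq => x; have := T0 x.
  rewrite (_ : \int[Q]_x phi x = 0); last first.
    by apply: integral0_eq => x; have := T0 x.
  rewrite integral0_eq ?mule0 ?adde0//.
  by move=> x; have := T0 x.
have c0 : (0 <= c)%R.
  by have /andP[a b] := phi01 x0; rewrite -lee_fin (le_trans a b).
rewrite (density_integral hf)// (density_integral hg)//.
rewrite -ge0_integralZl//; [|exact/measurable_EFinP|by move=> x _; rewrite lee_fin].
have mgphi : measurable_fun setT (fun x => (g x)%:E * phi x).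
  by apply: emeasurable_funM => //; exact/measurable_EFinP.
have mfphi : measurable_fun setT (fun x => (f x)%:E * phi x).
  by apply: emeasurable_funM => //; exact/measurable_EFinP.
have mcr : measurable_fun setT (fun x => c%:E * (Num.max (f x - g x) 0)%:E).
  by apply: emeasurable_funM => //; exact/measurable_EFinP.
rewrite -ge0_integralD//; last 2 first.
- by move=> x _; rewrite mule_ge0// lee_fin.
- by move=> x _; rewrite mule_ge0// lee_fin.
apply: ge0_le_integral => //.
- by move=> x _; rewrite mule_ge0// lee_fin.
- exact: emeasurable_funD.
move=> x _; have := phi01 x; case: (phi x) => [p| |]; last 2 first.
- by rewrite !leye_eq andbF.
- by rewrite leNye andbT leeNy_eq.
move=> /andP[+ +]; rewrite -!EFinM -EFinD !lee_fin => p0 pc.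
have [h|h] := leP (f x - g x)%R 0%R; nra.
Qed.

(** The set where [f >= g] is extremal. It turns total variation into a maximum of [P A - Q A], in
    which no dominating measure occurs. *)
Lemma pos_part_attained nu P Q f g : is_density nu P f -> is_density nu Q g ->
  exists2 A, measurable A &
    P A = Q A + \int[nu]_x (Num.max (f x - g x) 0)%:E.
Proof.
move=> hf hg; have [mf f0 fE] := hf; have [mg g0 gE] := hg.
have mfg : measurable_fun setT (fun x => f x - g x)%R by exact: measurable_funB.
have mr : measurable_fun setT (fun x => Num.max (f x - g x) 0)%R.
  by apply: measurable_maxr.
pose A := [set x | (0 <= f x - g x)%R].
have mA : measurable A.
  rewrite (_ : A = (fun x => f x - g x)%R @^-1` `[0%R, +oo[); last first.
    by apply/seteqP; split => x /=; rewrite in_itv/= andbT.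
  by rewrite -[X in measurable X]setTI; exact: mfg.
exists A => //; rewrite fE// gE// !(integral_mkcond A) -ge0_integralD//.
- apply: eq_integral => x _; rewrite /patch; case: ifPn.
    by rewrite inE /A/= => h; rewrite -EFinD; congr EFin; rewrite max_l//; ring.
  rewrite notin_setE /A/= => /negP; rewrite -ltNge => h.
  by rewrite max_r ?ltW// adde0.
- by move=> x _; rewrite /patch; case: ifPn => // _; rewrite lee_fin.
- by apply/(measurable_restrictT _ mA).1; apply: measurable_funTS; exact/measurable_EFinP.
- by move=> x _; rewrite lee_fin le_max lexx orbT.
- exact/measurable_EFinP.
Qed.

Lemma dTV_eq nu P Q f g : is_density nu P f -> is_density nu Q g ->
  d_TV P Q = \int[nu]_x (Num.max (f x - g x) 0)%:E.
Proof.
move=> hf hg; apply/eqP; rewrite eq_le; apply/andP; split.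
  apply: ereal_inf_lbound; exists nu, f, g; split=> //.
  by rewrite (integral_pos_part hf hg).
apply: le_ereal_inf_tmp => _ [nu' [f' [g' [hf' hg' ->]]]].
rewrite (integral_pos_part hf' hg').
(* The set extremal for [nu] is tested against the densities with respect to [nu']. *)
have [A mA PA] := pos_part_attained hf hg.
rewrite -(@leeD2lE _ (Q A)) ?fin_num_measure// -PA.
have := @integral_le_pos_part nu' P Q f' g' (fun x => (\1_A x)%:E) 1 hf' hg'.
rewrite -!integral_indicE// mul1e; apply; first exact: measurable_indicE.
by move=> x; rewrite !lee_fin indicE; case: (_ \in _); rewrite /= ?lexx ler01.
Qed.

Lemma dTV_integral_le P Q phi (c : R) : measurable_fun setT phi ->
    (forall x, 0 <= phi x <= c%:E) ->
  \int[P]_x phi x <= \int[Q]_x phi x + c%:E * d_TV P Q.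
Proof.
move=> mphi phi01; have [nu [f [g [_ [hf hg _]]]]] := exists_common_density P Q Q.
by rewrite (dTV_eq hf hg); exact: integral_le_pos_part.
Qed.

Lemma dTV_measure_le P Q A : measurable A -> P A <= Q A + d_TV P Q.
Proof.
move=> mA; have := @dTV_integral_le P Q (fun x => (\1_A x)%:E) 1.
rewrite -!integral_indicE// mul1e; apply; first exact: measurable_indicE.
by move=> x; rewrite !lee_fin indicE; case: (_ \in _); rewrite /= ?lexx ler01.
Qed.

Lemma dTV_attained P Q : exists2 A, measurable A & P A = Q A + d_TV P Q.
Proof.
have [nu [f [g [_ [hf hg _]]]]] := exists_common_density P Q Q.
by rewrite (dTV_eq hf hg); exact: pos_part_attained hf hg.
Qed.

Lemma dTV_le P Q (x : \bar R) :
  (forall A, measurable A -> P A <= Q A + x) -> d_TV P Q <= x.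
Proof.
move=> h; have [A mA PA] := dTV_attained P Q.
by rewrite -(@leeD2lE _ (Q A)) ?fin_num_measure// -PA; exact: h.
Qed.

Lemma dTV_ge0 P Q : 0 <= d_TV P Q.
Proof.
by have := dTV_measure_le P Q measurableT; rewrite !probability_setT -{1}[1]adde0
  leeD2lE.
Qed.

Lemma dTV_sym P Q : d_TV P Q = d_TV Q P.
Proof.
by rewrite /d_TV; congr ereal_inf; apply/seteqP; split => _ [nu [f [g [hf hg ->]]]];
  exists nu, g, f; split => //; congr (_ * _); apply: eq_integral => x _;
  rewrite distrC.
Qed.

Lemma dTV_triangle P S Q : d_TV P Q <= d_TV P S + d_TV S Q.
Proof.
apply: dTV_le => A mA; apply: le_trans (dTV_measure_le P S mA) _.
rewrite [d_TV P S + _]addeC addeA; apply: leeD2r; exact: dTV_measure_le.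
Qed.

End TotalVariation.

(** * Posteriors as kernels *)

Section Kernel.
Context {R : realType} {d d' : measure_display}
  {T : measurableType d} {U : measurableType d'}.
Variables (lam : {sigma_finite_measure set U -> \bar R}).
Variables (Phi : U * T -> T) (G : U * T -> R).
Hypothesis mPhi : measurable_fun setT Phi.
Hypothesis mG : measurable_fun setT G.
Hypothesis G0 : forall w, (0 <= G w)%R.
Implicit Types (P Q : probability T R) (g : T -> \bar R).

(** The adjoint of the unnormalised update: integrating [g] against the updated measure is
    integrating [kap g] against the prior. In particular [kap (cst 1) z] is the mass sent out from
    [z]. *)
Definition kap g z := \int[lam]_u ((G (u, z))%:E * g (Phi (u, z))).

Lemma measurable_kap_integrand g : measurable_fun setT g ->
  measurable_fun setT (fun w => (G w)%:E * g (Phi w)).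
Proof.
move=> mg; apply: emeasurable_funM; first exact/measurable_EFinP.
exact: measurableT_comp.
Qed.

Lemma kap_integrand_ge0 g : (forall x, 0 <= g x) ->
  forall w, 0 <= (G w)%:E * g (Phi w).
Proof. by move=> g0 w; rewrite mule_ge0// lee_fin. Qed.

Lemma measurable_kap g : measurable_fun setT g -> (forall x, 0 <= g x) ->
  measurable_fun setT (kap g).
Proof.
move=> mg g0; apply: (@measurable_fun_fubini_tonelli_G _ _ _ _ _ lam
  (fun w => (G w)%:E * g (Phi w))).
- exact: measurable_kap_integrand.
- exact: kap_integrand_ge0.
Qed.

Lemma kap_ge0 g z : (forall x, 0 <= g x) -> 0 <= kap g z.
Proof. by move=> g0; apply: integral_ge0 => u _; exact: kap_integrand_ge0. Qed.

Lemma measurable_section g z : measurable_fun setT g ->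
  measurable_fun setT (fun u => (G (u, z))%:E * g (Phi (u, z))).
Proof.
move=> mg; apply: (measurableT_comp (measurable_kap_integrand mg)).
exact: pair2_measurable.
Qed.

Lemma le_kap g g' z : measurable_fun setT g -> measurable_fun setT g' ->
  (forall x, 0 <= g x) -> (forall x, g x <= g' x) -> kap g z <= kap g' z.
Proof.
move=> mg mg' g0 gg'; apply: ge0_le_integral => //.
- by move=> u _; exact: kap_integrand_ge0.
- exact: measurable_section.
- exact: measurable_section.
- by move=> u _; rewrite lee_wpmul2l// lee_fin.
Qed.

(** Bayes' rule in weak form. Multiplying by [Z] instead of dividing keeps the identity usable when
    a side is infinite. *)
Definition is_post P (Z : R) P' := (0 < Z)%R /\
  forall g, measurable_fun setT g -> (forall x, 0 <= g x) ->
    Z%:E * \int[P']_x g x = \int[P]_z kap g z.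

(** The posterior is the image under [Phi] of the measure with density [G / Z] with respect to
    [lam \x P]. *)
Lemma exists_post P (Z : R) : (0 < Z)%R -> \int[P]_z kap (cst 1) z = Z%:E ->
  exists P', is_post P Z P'.
Proof.
move=> Z0 ZE; pose f w := (G w / Z)%R.
have mf : measurable_fun setT f by apply: measurable_funM.
have f0 w : (0 <= f w)%R by rewrite divr_ge0// ltW.
have [mu muE] := exists_image_measure (lam \x P) mf f0 mPhi.
have H g : measurable_fun setT g -> (forall x, 0 <= g x) ->
    Z%:E * \int[mu]_x g x = \int[P]_z kap g z.
  move=> mg g0; rewrite muE// -ge0_integralZl//; last 3 first.
  - apply: emeasurable_funM; first exact/measurable_EFinP.
    exact: measurableT_comp.
  - by move=> w _; rewrite mule_ge0// lee_fin.
  - by rewrite lee_fin ltW.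
  rewrite (eq_integral (fun w => (G w)%:E * g (Phi w))); last first.
    by move=> w _; rewrite muleA -EFinM /f mulrC divfK// gt_eqF.
  rewrite fubini_tonelli2//; first exact: measurable_kap_integrand.
  exact: kap_integrand_ge0.
have [|P' P'E] := @exists_probability _ _ _ mu.
  have : Z%:E * \int[mu]_x (cst 1 x) = Z%:E by rewrite H.
  rewrite integral_cst// mul1e => /(congr1 (fun x => Z^-1%:E * x)).
  by rewrite muleA -!EFinM mulVf ?gt_eqF// mul1e.
by exists P'; split => // g mg g0; rewrite -(eqm_integral _ _ P'E) H.
Qed.

Lemma is_post_mass P Z P' : is_post P Z P' -> Z%:E = \int[P]_z kap (cst 1) z.
Proof.
move=> [_ h]; rewrite -h//.
by rewrite integral_cst//= mul1e probability_setT mule1.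
Qed.

Variables (c : R).
Hypothesis c0 : (0 <= c)%R.
Hypothesis kap1 : forall z, kap (cst 1) z <= c%:E.

(** Testing with the adjoint of an indicator gives [Zp P'(A) <= Zq Q'(A) + c d_TV(P,Q)], and
    [Zq <= Zp] lets [Zp] be divided out. One-sided bounds on sets suffice for [d_TV], so symmetry
    then yields the larger evidence in general. *)
Lemma dTV_post_half P Q Zp Zq P' Q' : is_post P Zp P' -> is_post Q Zq Q' ->
  (Zq <= Zp)%R -> d_TV P' Q' <= (c / Zp)%:E * d_TV P Q.
Proof.
move=> [Zp0 hP] [Zq0 hQ] ZZ; apply: dTV_le => A mA.
have m1 : measurable_fun setT (fun x => (\1_A x : R)%:E) by exact: measurable_indicE.
have p1 x : 0 <= (\1_A x : R)%:E by rewrite lee_fin.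
have := @dTV_integral_le R d T P Q (kap (fun x => (\1_A x)%:E)) c
  (measurable_kap m1 p1).
rewrite -hP// -hQ// -!integral_indicE// => H.
have : Zp%:E * P' A <= Zq%:E * Q' A + c%:E * d_TV P Q.
  apply: H => z; rewrite kap_ge0//= (le_trans _ (kap1 z))//; apply: le_kap => //.
  by move=> x; rewrite lee_fin indicE; case: (_ \in _); rewrite /= ?lexx ?ler01.
move=> {}H; rewrite -(@lee_pmul2l _ Zp%:E)// ?lte_fin//.
apply: (le_trans H); rewrite ge0_muleDr//; last first.
  by rewrite mule_ge0 ?dTV_ge0// lee_fin divr_ge0// ltW.
rewrite muleA -EFinM mulrC divfK ?gt_eqF// leeD2r// lee_wpmul2r// lee_fin//.
Qed.

Lemma dTV_post P Q Zp Zq P' Q' : is_post P Zp P' -> is_post Q Zq Q' ->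
  d_TV P' Q' <= (c / Num.max Zp Zq)%:E * d_TV P Q.
Proof.
move=> hP hQ; have [ZZ|ZZ] := leP Zp Zq; last exact: dTV_post_half hP hQ (ltW ZZ).
by rewrite dTV_sym (dTV_sym P); exact: dTV_post_half hQ hP ZZ.
Qed.

End Kernel.

(** * Hellinger distance *)

Section RealLemmas.
Context {R : realType}.
Implicit Types a b c e f g s t x y : R.
Local Open Scope ring_scope.

(** Young's inequality. Asking for [1 <= t * t'] instead of [t' = t^-1] makes it stable under the
    weights used later. Times [t], the gap is [(t a - b)^2 + (t t' - 1) b^2]. *)
Lemma am_gm_pair t t' a b : 0 <= t -> 0 <= t' -> 1 <= t * t' ->
  2 * (a * b) <= t * a ^+ 2 + t' * b ^+ 2.
Proof.
move=> t0 t'0 tt'; have tp : 0 < t.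
  by rewrite lt_def t0 andbT; apply/eqP => E; move: tt'; rewrite E mul0r ler10.
have e : t * (t * a ^+ 2 + t' * b ^+ 2 - 2 * (a * b)) =
  (t * a - b) ^+ 2 + (t * t' - 1) * b ^+ 2 by ring.
rewrite -subr_ge0 -(pmulr_rge0 _ tp) e addr_ge0 ?sqr_ge0// mulr_ge0 ?sqr_ge0//.
by rewrite subr_ge0.
Qed.

(** The infimum over [s] of the right-hand side is [(sqrt a + sqrt b)^2]. A family of linear
    inequalities between integrals thus yields a triangle inequality in [L^2]. *)
Lemma sqrt_minkowski a b c : 0 <= a -> 0 <= b ->
  (forall s, 0 < s -> c <= (1 + s) * a + (1 + s^-1) * b) ->
  Num.sqrt c <= Num.sqrt a + Num.sqrt b.
Proof.
move=> a0 b0 h; apply/ler_addgt0Pr => e e0.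
(* The optimal [s] is [sqrt b / sqrt a]; the shift by [e / 2] keeps it defined and positive when [a]
   or [b] vanishes. *)
set x := Num.sqrt a + e / 2; set y := Num.sqrt b + e / 2.
have sa : 0 <= Num.sqrt a by exact: sqrtr_ge0.
have sb : 0 <= Num.sqrt b by exact: sqrtr_ge0.
have x0 : 0 < x by rewrite /x; lra.
have y0 : 0 < y by rewrite /y; lra.
have ax : a <= x ^+ 2 by rewrite -(sqr_sqrtr a0) ler_sqr ?nnegrE /x; lra.
have bx : b <= y ^+ 2 by rewrite -(sqr_sqrtr b0) ler_sqr ?nnegrE /y; lra.
have -> : Num.sqrt a + Num.sqrt b + e = x + y by rewrite /x /y; field.
rewrite -(ger0_norm (_ : 0 <= x + y)); last lra.
rewrite -sqrtr_sqr ler_wsqrtr//.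
apply: le_trans (h (y / x) _) _; first by rewrite divr_gt0.
have -> : (x + y) ^+ 2 = (1 + y / x) * x ^+ 2 + (1 + (y / x)^-1) * y ^+ 2.
  by field; rewrite !gt_eqF.
have yx : 0 <= y / x by rewrite divr_ge0 ?ltW.
by apply: lerD; apply: ler_wpM2l => //; rewrite addr_ge0// invr_ge0.
Qed.

(** Because [x^2 + y^2 - 2 x y b = (y - x b)^2 + x^2 (1 - b) + x^2 b (1 - b)]. This is where the
    dependence on the other evidence [y] disappears. *)
Lemma sqrt_affinity_bound x y b e : 0 < x -> 0 < y -> 0 <= b <= 1 ->
  x ^+ 2 + y ^+ 2 <= 2 * (x * y * b) + e -> x ^+ 2 * (1 - b) <= e.
Proof.
move=> x0 y0 /andP[b0 b1] h.
have h1 : 0 <= (y - x * b) ^+ 2 by exact: sqr_ge0.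
have h2 : 0 <= x ^+ 2 * (b * (1 - b)).
  by rewrite mulr_ge0 ?sqr_ge0// mulr_ge0// subr_ge0.
nra.
Qed.

(** Regularising the optimal weight costs at most [dl * (f + g)], which is integrable with integral
    [2 * dl] when [f] and [g] are probability densities. *)
Lemma affinity_perturbation f g (dl : R) : 0 <= f -> 0 <= g -> 0 < dl -> 0 < f + g ->
  let t := Num.sqrt (g + dl ^+ 2 * (f + g)) / Num.sqrt (f + dl ^+ 2 * (f + g)) in
  t * f <= Num.sqrt f * Num.sqrt g + dl * (f + g).
Proof.
move=> f0 g0 d0 s0 /=; set s := f + g.
have ds : 0 < dl ^+ 2 * s by rewrite mulr_gt0// exprn_gt0.
have p0 : 0 < f + dl ^+ 2 * s by rewrite ltr_wpDl.
have sp : 0 < Num.sqrt (f + dl ^+ 2 * s) by rewrite sqrtr_gt0.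
have h1 : f / Num.sqrt (f + dl ^+ 2 * s) <= Num.sqrt f.
  rewrite ler_pdivrMr// -{1}(sqr_sqrtr f0) expr2 ler_wpM2l ?sqrtr_ge0//.
  by rewrite ler_wsqrtr// lerDl ltW.
have h2 : Num.sqrt (g + dl ^+ 2 * s) <= Num.sqrt g + dl * Num.sqrt s.
  have e0 : 0 <= Num.sqrt g + dl * Num.sqrt s.
    by rewrite addr_ge0 ?sqrtr_ge0// mulr_ge0 ?sqrtr_ge0 ?ltW.
  rewrite -(ger0_norm e0) -sqrtr_sqr ler_wsqrtr// sqrrD exprMn !sqr_sqrtr ?(ltW s0)//.
  by rewrite lerD2r lerDl mulrn_wge0// !mulr_ge0 ?sqrtr_ge0// ltW.
have h3 : Num.sqrt f * Num.sqrt s <= s.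
  have sE : s = Num.sqrt s ^+ 2 by rewrite sqr_sqrtr// ltW.
  rewrite [leRHS]sE expr2 ler_wpM2r ?sqrtr_ge0//.
  by rewrite ler_wsqrtr// lerDl.
rewrite mulrAC -mulrA.
apply: le_trans (ler_wpM2l (@sqrtr_ge0 R _) h1) _.
apply: le_trans (ler_wpM2r (@sqrtr_ge0 R _) h2) _.
have -> : (Num.sqrt g + dl * Num.sqrt s) * Num.sqrt f =
   Num.sqrt f * Num.sqrt g + dl * (Num.sqrt f * Num.sqrt s) by ring.
by rewrite lerD2l ler_wpM2l// ltW.
Qed.

End RealLemmas.

Section MeasurableReal.
Context {R : realType} {d : measure_display} {T : measurableType d}.

Lemma measurable_sqrt (f : T -> R) : measurable_fun setT f ->
  measurable_fun setT (fun x => Num.sqrt (f x)).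
Proof.
move=> mf; apply: measurableT_comp mf.
by apply: continuous_measurable_fun; exact: sqrt_continuous.
Qed.

(** Inversion is not continuous at 0, but on nonnegative reals it is the power of exponent -1, with
    the same value 0 at 0. *)
Lemma measurable_inv_ge0 (f : T -> R) : measurable_fun setT f ->
  (forall x, 0 <= f x)%R -> measurable_fun setT (fun x => (f x)^-1)%R.
Proof.
move=> mf f0; apply: (eq_measurable_fun (fun x => powR (f x) (-1))).
  by move=> x _; rewrite powR_inv1.
exact: (measurableT_comp (measurable_powR (-1)) mf).
Qed.

End MeasurableReal.

Section Hellinger.
Context {R : realType} {d : measure_display} {T : measurableType d}.
Implicit Types (P Q S : probability T R) (nu : {measure set T -> \bar R}).
Implicit Types f g t : T -> R.

(** The Bhattacharyya coefficient. *)
Definition affinity (nu : set T -> \bar R) f g : \bar R :=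
  \int[nu]_x (Num.sqrt (f x) * Num.sqrt (g x))%:E.

Lemma measurable_sqrt_mul f g : measurable_fun setT f -> measurable_fun setT g ->
  measurable_fun setT (fun x => (Num.sqrt (f x) * Num.sqrt (g x))%:E).
Proof.
by move=> mf mg; apply/measurable_EFinP; apply: measurable_funM; exact: measurable_sqrt.
Qed.

Lemma measurable_sqr_sqrt_sub f g : measurable_fun setT f -> measurable_fun setT g ->
  measurable_fun setT (fun x => ((Num.sqrt (f x) - Num.sqrt (g x)) ^+ 2)%:E).
Proof.
move=> mf mg; apply/measurable_EFinP; apply: measurable_funX.
by apply: measurable_funB; exact: measurable_sqrt.
Qed.

Ltac integral_side := try solve
  [ by move=> ? _; rewrite ?adde_ge0 ?mule_ge0 ?lee_fin ?sqr_ge0 ?mulr_ge0 ?sqrtr_ge0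
      ?addr_ge0
  | exact: measurable_sqr_sqrt_sub | exact: measurable_sqrt_mul
  | exact/measurable_EFinP
  | by do ?[exact: measurable_sqr_sqrt_sub | exact: measurable_sqrt_mul
          | exact/measurable_EFinP | apply: emeasurable_funM | apply: emeasurable_funD] ].

Lemma affinity_ge0 nu f g : 0 <= affinity nu f g.
Proof. by apply: integral_ge0 => x _; rewrite lee_fin mulr_ge0 ?sqrtr_ge0. Qed.

Lemma affinity_sqr_sqrt_sub nu P Q f g : is_density nu P f -> is_density nu Q g ->
  \int[nu]_x ((Num.sqrt (f x) - Num.sqrt (g x)) ^+ 2)%:E + 2%:E * affinity nu f g
  = 2%:E.
Proof.
move=> hf hg; have [mf f0 _] := hf; have [mg g0 _] := hg.
have p0 x : 0 <= (Num.sqrt (f x) * Num.sqrt (g x))%:E.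
  by rewrite lee_fin mulr_ge0 ?sqrtr_ge0.
rewrite -ge0_integralZl//; integral_side.
rewrite -ge0_integralD//; integral_side.
rewrite [RHS](_ : _ = \int[nu]_x (f x)%:E + \int[nu]_x (g x)%:E); last first.
  by rewrite (density_integral1 hf) (density_integral1 hg) -EFinD.
rewrite -[RHS]ge0_integralD//; integral_side.
apply: eq_integral => x _; rewrite -EFinM -!EFinD; congr EFin.
by rewrite sqrrB !sqr_sqrtr//; ring.
Qed.

(** Two nonnegative terms with sum 2 are finite; hence the [fine] in [d_H] hides no infinite
    value. *)
Lemma affinity_real nu P Q f g : is_density nu P f -> is_density nu Q g ->
  exists a : R, [/\ affinity nu f g = a%:E, (0 <= a <= 1)%R &
   \int[nu]_x ((Num.sqrt (f x) - Num.sqrt (g x)) ^+ 2)%:E = (2 * (1 - a))%:E].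
Proof.
move=> hf hg; have := affinity_sqr_sqrt_sub hf hg; have := affinity_ge0 nu f g.
have : 0 <= \int[nu]_x ((Num.sqrt (f x) - Num.sqrt (g x)) ^+ 2)%:E.
  by apply: integral_ge0 => x _; rewrite lee_fin sqr_ge0.
case: (integral _ _ _) => [h| |]//; case: (affinity nu f g) => [a| |]//.
- rewrite !lee_fin -EFinM -EFinD => h0 a0 [E]; exists a; split => //; first lra.
  by congr EFin; lra.
- by rewrite mulry gtr0_sg// mul1e.
- by rewrite mulry gtr0_sg// mul1e.
Qed.

Lemma affinity_le nu P Q f g t (t' : T -> R) : is_density nu P f -> is_density nu Q g ->
  measurable_fun setT t -> measurable_fun setT t' ->
  (forall x, 0 <= t x)%R -> (forall x, 0 <= t' x)%R ->
  (forall x, 1 <= t x * t' x)%R ->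
  2%:E * affinity nu f g <= \int[P]_x (t x)%:E + \int[Q]_x (t' x)%:E.
Proof.
move=> hf hg mt mt' t0 t'0 tt'; have [mf f0 _] := hf; have [mg g0 _] := hg.
rewrite (density_integral hf)//; integral_side.
rewrite (density_integral hg)//; integral_side.
rewrite -ge0_integralZl//; integral_side.
have mft : measurable_fun setT (fun x => (f x)%:E * (t x)%:E).
  by apply: emeasurable_funM; exact/measurable_EFinP.
have mgt : measurable_fun setT (fun x => (g x)%:E * (t' x)%:E).
  by apply: emeasurable_funM; exact/measurable_EFinP.
rewrite -ge0_integralD//; integral_side.
apply: ge0_le_integral => //; integral_side.
move=> x _; rewrite -!EFinM -EFinD lee_fin.
have := am_gm_pair (Num.sqrt (f x)) (Num.sqrt (g x)) (t0 x) (t'0 x) (tt' x).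
by rewrite !sqr_sqrtr// [(t x * _)%R]mulrC [(t' x * _)%R]mulrC.
Qed.

(* The optimal weight is sqrt (g / f); adding [dl ^+ 2 * (f + g)] to both terms
   makes it finite and positive wherever [f + g] is. *)
Lemma affinity_near nu P Q f g (e : R) : is_density nu P f -> is_density nu Q g ->
  (0 < e)%R ->
  exists t t' : T -> R, [/\ measurable_fun setT t /\ measurable_fun setT t',
    (forall x, 0 <= t x)%R, (forall x, 0 <= t' x)%R,
    (forall x, 1 <= t x * t' x)%R &
    \int[P]_x (t x)%:E + \int[Q]_x (t' x)%:E <= 2%:E * affinity nu f g + e%:E].
Proof.
move=> hf hg e0; have [mf f0 _] := hf; have [mg g0 _] := hg.
(* Each of the two weights loses [dl * (f + g)], and [f + g] has mass 2: the total error is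
   [4 * dl]. *)
pose dl := (e / 4)%R; have dl0 : (0 < dl)%R by rewrite divr_gt0.
pose F x := Num.sqrt (f x + dl ^+ 2 * (f x + g x)).
pose H x := Num.sqrt (g x + dl ^+ 2 * (f x + g x)).
have mF : measurable_fun setT F.
  apply: measurable_sqrt; apply: measurable_funD => //; apply: measurable_funM => //.
  exact: measurable_funD.
have mH : measurable_fun setT H.
  apply: measurable_sqrt; apply: measurable_funD => //; apply: measurable_funM => //.
  exact: measurable_funD.
have mz : measurable_fun setT (fun x => f x + g x == 0)%R.
  by apply: measurable_fun_eqr => //; exact: measurable_funD.
have F0 x : (0 <= F x)%R by exact: sqrtr_ge0.
have H0 x : (0 <= H x)%R by exact: sqrtr_ge0.
pose t x := (if f x + g x == 0 then 1 else H x / F x)%R.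
pose t' x := (if f x + g x == 0 then 1 else F x / H x)%R.
have mt : measurable_fun setT t.
  apply: measurable_fun_ifT => //; apply: measurable_funM => //.
  exact: measurable_inv_ge0.
have mt' : measurable_fun setT t'.
  apply: measurable_fun_ifT => //; apply: measurable_funM => //.
  exact: measurable_inv_ge0.
have t0 x : (0 <= t x)%R by rewrite /t; case: ifP => // _; rewrite divr_ge0.
have t'0 x : (0 <= t' x)%R by rewrite /t'; case: ifP => // _; rewrite divr_ge0.
have fg0 x : (f x + g x != 0 -> 0 < f x + g x)%R.
  by rewrite lt_def => ->; rewrite addr_ge0.
exists t, t'; split => //.
  move=> x; rewrite /t /t'; case: ifPn => [_|/fg0 s0]; first by rewrite mul1r.
  have ds : (0 < dl ^+ 2 * (f x + g x))%R by rewrite mulr_gt0// exprn_gt0.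
  have Fp : (0 < F x)%R by rewrite sqrtr_gt0 ltr_wpDl.
  have Hp : (0 < H x)%R by rewrite sqrtr_gt0 ltr_wpDl.
  rewrite (_ : _ * _ = 1)%R//; field.
  by rewrite !gt_eqF.
rewrite (density_integral hf)//; integral_side.
rewrite (density_integral hg)//; integral_side.
have mft : measurable_fun setT (fun x => (f x)%:E * (t x)%:E).
  by apply: emeasurable_funM; exact/measurable_EFinP.
have mgt : measurable_fun setT (fun x => (g x)%:E * (t' x)%:E).
  by apply: emeasurable_funM; exact/measurable_EFinP.
rewrite -ge0_integralD//; integral_side.
have mfg : measurable_fun setT (fun x => (f x)%:E + (g x)%:E).
  by apply: emeasurable_funD; exact/measurable_EFinP.
have mfge : measurable_fun setT (fun x => (2 * dl)%:E * ((f x)%:E + (g x)%:E)).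
  exact: emeasurable_funM.
have msq := measurable_sqrt_mul mf mg.
have m2sq : measurable_fun setT
    (fun x => 2%:E * (Num.sqrt (f x) * Num.sqrt (g x))%:E).
  exact: emeasurable_funM.
have -> : e%:E = \int[nu]_x ((2 * dl)%:E * ((f x)%:E + (g x)%:E)).
  rewrite ge0_integralZl//; integral_side; last by rewrite lee_fin mulr_ge0// ltW.
  rewrite ge0_integralD//; integral_side.
  rewrite (density_integral1 hf) (density_integral1 hg) -EFinD -EFinM /dl.
  by congr EFin; field.
rewrite /affinity -ge0_integralZl//; integral_side.
rewrite -ge0_integralD//; integral_side; last first.
  by move=> x _; rewrite mule_ge0 ?adde_ge0 ?lee_fin// mulr_ge0// ltW.
apply: ge0_le_integral => //; integral_side.
move=> x _; suff : (f x * t x + g x * t' x <=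
    2 * (Num.sqrt (f x) * Num.sqrt (g x)) + 2 * dl * (f x + g x))%R.
  by rewrite -lee_fin; apply.
rewrite /t /t'.
case: ifPn => [/eqP s0|/fg0 s0].
  have -> : f x = 0%R by have := f0 x; have := g0 x; lra.
  have -> : g x = 0%R by have := f0 x; have := g0 x; lra.
  by rewrite sqrtr0; lra.
have h1 := affinity_perturbation (f0 x) (g0 x) dl0 s0.
rewrite addrC in s0.
have h2 := affinity_perturbation (g0 x) (f0 x) dl0 s0.
move: h1 h2; rewrite /= [(g x + f x)%R]addrC -/(F x) -/(H x).
by rewrite [(H x / F x * _)%R]mulrC [(F x / H x * _)%R]mulrC; lra.
Qed.

(** The integrals of the weights against [P] and [Q] do not mention the dominating measure, so
    weights nearly optimal for one of them bound the affinity for the other. *)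
Lemma affinity_unique nu nu' P Q f g f' g' : is_density nu P f -> is_density nu Q g ->
  is_density nu' P f' -> is_density nu' Q g' -> affinity nu f g = affinity nu' f' g'.
Proof.
suff H nu1 nu1' f1 g1 f1' g1' : is_density nu1 P f1 -> is_density nu1 Q g1 ->
    is_density nu1' P f1' -> is_density nu1' Q g1' ->
    affinity nu1 f1 g1 <= affinity nu1' f1' g1'.
  by move=> hf hg hf' hg'; apply/eqP; rewrite eq_le; apply/andP; split; exact: H.
move=> hf hg hf' hg'; rewrite -(@lee_pmul2l _ 2%:E)// ?lte_fin//.
apply/lee_addgt0Pr => e e0.
have [t [t' [[mt mt'] t0 t'0 tt' h]]] := affinity_near hf' hg' e0.
by apply: le_trans h; exact: affinity_le.
Qed.

Lemma dH_eq nu P Q f g : is_density nu P f -> is_density nu Q g ->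
  d_H P Q = (Num.sqrt (1 - fine (affinity nu f g)))%:E.
Proof.
move=> hf hg.
have E nu1 f1 g1 : is_density nu1 P f1 -> is_density nu1 Q g1 ->
  Num.sqrt (2^-1 *
      fine (\int[nu1]_x ((Num.sqrt (f1 x) - Num.sqrt (g1 x)) ^+ 2)%:E)) =
  Num.sqrt (1 - fine (affinity nu f g)).
  move=> hf1 hg1; rewrite (affinity_unique hf hg hf1 hg1).
  have [a [-> _ ->]] := affinity_real hf1 hg1; congr Num.sqrt => /=.
  by rewrite mulrA mulVf// mul1r.
rewrite /d_H; set A := (X in ereal_inf X).
(* All admissible choices give the same value: the infimum is over a singleton. *)
suff -> : A = [set (Num.sqrt (1 - fine (affinity nu f g)))%:E].
  by rewrite ereal_inf1.
apply/seteqP; split => [_ [nu1 [f1 [g1 [hf1 hg1 ->]]]]|_ ->] /=.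
  by rewrite (E _ _ _ hf1 hg1).
by exists nu, f, g; split => //; rewrite (E _ _ _ hf hg).
Qed.

Lemma dH_ge0 P Q : 0 <= d_H P Q.
Proof.
have [nu [f [g [_ [hf hg _]]]]] := exists_common_density P Q Q.
by rewrite (dH_eq hf hg) lee_fin sqrtr_ge0.
Qed.

(** Integrate [(u - w)^2 <= (1 + s) (u - v)^2 + (1 + s^-1) (v - w)^2] for the square roots of the
    three densities, then optimise over [s]. *)
Lemma dH_triangle P S Q : d_H P Q <= d_H P S + d_H S Q.
Proof.
have [nu [f [h [g [hf hh hg]]]]] := exists_common_density P S Q.
have [mf f0 _] := hf; have [mg g0 _] := hg; have [mh h0 _] := hh.
rewrite (dH_eq hf hg) (dH_eq hf hh) (dH_eq hh hg) -EFinD lee_fin.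
have [a [aE /andP[_ a1] Ia]] := affinity_real hf hh.
have [b [bE /andP[_ b1] Ib]] := affinity_real hh hg.
have [c [cE /andP[_ c1] Ic]] := affinity_real hf hg.
rewrite aE bE cE /=; apply: sqrt_minkowski; rewrite ?subr_ge0// => s s0.
have s1 : (0 <= 1 + s)%R by rewrite addr_ge0// ltW.
have s2 : (0 <= 1 + s^-1)%R by rewrite addr_ge0// invr_ge0 ltW.
suff : (2 * (1 - c))%:E <=
    (1 + s)%:E * (2 * (1 - a))%:E + (1 + s^-1)%:E * (2 * (1 - b))%:E.
  rewrite -!EFinM -EFinD lee_fin !(mulrCA _ 2%R) -mulrDr.
  by rewrite ler_pM2l.
rewrite -Ia -Ib -Ic.
have mab := measurable_sqr_sqrt_sub mf mh.
have mbc := measurable_sqr_sqrt_sub mh mg.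
rewrite -!ge0_integralZl//; integral_side.
rewrite -ge0_integralD//; integral_side.
apply: ge0_le_integral => //; integral_side.
move=> x _; rewrite -!EFinM -EFinD lee_fin.
set u := Num.sqrt (f x); set v := Num.sqrt (h x); set w := Num.sqrt (g x).
rewrite -subr_ge0.
suff -> : ((1 + s) * (u - v) ^+ 2 + (1 + s^-1) * (v - w) ^+ 2 - (u - w) ^+ 2 =
   s * ((u - v) - s^-1 * (v - w)) ^+ 2)%R by rewrite mulr_ge0 ?sqr_ge0// ltW.
- by field; rewrite gt_eqF.
- by move=> x _; rewrite mule_ge0 ?lee_fin ?sqr_ge0.
- by move=> x _; rewrite mule_ge0 ?lee_fin ?sqr_ge0.
Qed.

Lemma dH_sym P Q : d_H P Q = d_H Q P.
Proof.
have [nu [f [g [_ [hf hg _]]]]] := exists_common_density P Q Q.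
rewrite (dH_eq hf hg) (dH_eq hg hf) /affinity.
by under eq_integral do rewrite mulrC.
Qed.

End Hellinger.

(** * The one-step bound in Hellinger distance *)

Section HellingerKernel.
Context {R : realType} {d d' : measure_display}
  {T : measurableType d} {U : measurableType d'}.
Variables (lam : {sigma_finite_measure set U -> \bar R}).
Variables (Phi : U * T -> T) (G : U * T -> R).
Hypothesis mPhi : measurable_fun setT Phi.
Hypothesis mG : measurable_fun setT G.
Hypothesis G0 : forall w, (0 <= G w)%R.
Implicit Types (P Q : probability T R).

Local Notation K := (kap lam Phi G).

(** Young's inequality with the weights [r t] and [r^-1 t'] at [Phi (u, z)], integrated against
    [G (u, z)]. The free [r] will absorb the two different evidences. *)
Lemma kap_am_gm z (t t' : T -> R) (a b r : R) :
  measurable_fun setT t -> measurable_fun setT t' ->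
  (forall x, 0 <= t x)%R -> (forall x, 0 <= t' x)%R ->
  (forall x, 1 <= t x * t' x)%R -> (0 <= a)%R -> (0 <= b)%R -> (0 < r)%R ->
  (2 * (Num.sqrt a * Num.sqrt b))%:E * K (cst 1) z <=
  (r * a)%:E * K (EFin \o t) z + (r^-1 * b)%:E * K (EFin \o t') z.
Proof.
move=> mt mt' t0 t'0 tt' a0 b0 r0.
have ra0 : (0 <= r * a)%R by rewrite mulr_ge0// ltW.
have rb0 : (0 <= r^-1 * b)%R by rewrite mulr_ge0// invr_ge0 ltW.
have ab0 : (0 <= 2 * (Num.sqrt a * Num.sqrt b))%R by rewrite !mulr_ge0 ?sqrtr_ge0.
have m1 : measurable_fun setT (fun u => (G (u, z))%:E * (cst 1 : T -> \bar R) (Phi (u, z))).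
  exact: measurable_section.
have m2 : measurable_fun setT (fun u => (G (u, z))%:E * (EFin \o t) (Phi (u, z))).
  by apply: measurable_section => //; exact/measurable_EFinP.
have m3 : measurable_fun setT (fun u => (G (u, z))%:E * (EFin \o t') (Phi (u, z))).
  by apply: measurable_section => //; exact/measurable_EFinP.
have p1 u : 0 <= (G (u, z))%:E * (cst 1 : T -> \bar R) (Phi (u, z)).
  by rewrite mule_ge0// lee_fin.
have p2 u : 0 <= (G (u, z))%:E * (EFin \o t) (Phi (u, z)).
  by rewrite mule_ge0// lee_fin.
have p3 u : 0 <= (G (u, z))%:E * (EFin \o t') (Phi (u, z)).
  by rewrite mule_ge0// lee_fin.
rewrite /kap -!ge0_integralZl//.
rewrite -ge0_integralD//; last 4 first.
- by move=> u _; rewrite mule_ge0.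
- exact: emeasurable_funM.
- by move=> u _; rewrite mule_ge0.
- exact: emeasurable_funM.
apply: ge0_le_integral => //.
- by move=> u _; rewrite mule_ge0.
- exact: emeasurable_funM.
- by apply: emeasurable_funD; exact: emeasurable_funM.
move=> u _; set w := (u, z).
suff : (2 * (Num.sqrt a * Num.sqrt b) * (G w * 1) <=
    r * a * (G w * t (Phi w)) + r^-1 * b * (G w * t' (Phi w)))%R.
  by rewrite -lee_fin; apply.
have h : (1 <= r * t (Phi w) * (r^-1 * t' (Phi w)))%R.
  by rewrite mulrACA divff ?gt_eqF// mul1r.
have h1 : (0 <= r * t (Phi w))%R by rewrite mulr_ge0// ltW.
have h2 : (0 <= r^-1 * t' (Phi w))%R by rewrite mulr_ge0// invr_ge0 ltW.
have := ler_wpM2l (G0 w) (am_gm_pair (Num.sqrt a) (Num.sqrt b) h1 h2 h).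
by rewrite !sqr_sqrtr//; lra.
Qed.

Variables (c : R).
Hypothesis c0 : (0 <= c)%R.
Hypothesis kap1 : forall z, K (cst 1) z <= c%:E.

(** Data processing for the unnormalised updates. Nearly optimal weights for the posteriors are
    pulled back to the priors by the adjoint, where Young's inequality gives a lower bound for their
    sum. *)
Lemma affinity_post (nu nu' : {measure set T -> \bar R}) P Q Zp Zq P' Q' f g p q :
  is_post lam Phi G P Zp P' -> is_post lam Phi G Q Zq Q' ->
  is_density nu P f -> is_density nu Q g ->
  is_density nu' P' p -> is_density nu' Q' q ->
  \int[nu]_z ((2 * (Num.sqrt (f z) * Num.sqrt (g z)))%:E * K (cst 1) z) <=
  (Num.sqrt Zp * Num.sqrt Zq)%:E * (2%:E * affinity nu' p q).
Proof.
move=> [Zp0 hP] [Zq0 hQ] hf hg hp hq.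
have [mf f0 _] := hf; have [mg g0 _] := hg.
have [b [bE _ _]] := affinity_real hp hq.
set x := Num.sqrt Zp; set y := Num.sqrt Zq.
have x0 : (0 < x)%R by rewrite sqrtr_gt0.
have y0 : (0 < y)%R by rewrite sqrtr_gt0.
have xE : (x ^+ 2 = Zp)%R by rewrite sqr_sqrtr// ltW.
have yE : (y ^+ 2 = Zq)%R by rewrite sqr_sqrtr// ltW.
apply/lee_addgt0Pr => e e0.
have [|t [t' [[mt mt'] t0 t'0 tt' h]]] := @affinity_near _ _ _ _ _ _ _ _ (e / (x * y)) hp hq.
  by rewrite divr_gt0// mulr_gt0.
have mEt : measurable_fun setT (EFin \o t) by exact/measurable_EFinP.
have mEt' : measurable_fun setT (EFin \o t') by exact/measurable_EFinP.
have Et0 z : 0 <= (EFin \o t) z by rewrite lee_fin.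
have Et'0 z : 0 <= (EFin \o t') z by rewrite lee_fin.
have {}h : (x * y)%:E * (\int[P']_x (t x)%:E + \int[Q']_x (t' x)%:E) <=
   (x * y)%:E * (2%:E * affinity nu' p q) + e%:E.
  apply: (le_trans (lee_wpmul2l _ h)); first by rewrite lee_fin mulr_ge0// ltW.
  have E : (x * y * (2 * b + e / (x * y)) = x * y * (2 * b) + e)%R.
    by field; rewrite !gt_eqF.
  by rewrite bE -[X in _ <= X](congr1 EFin E).
apply: le_trans h; rewrite ge0_muleDr//; last 2 first.
- by apply: integral_ge0 => z _; rewrite lee_fin.
- by apply: integral_ge0 => z _; rewrite lee_fin.
(* The weight [r = y / x] is forced by [x y = (y / x) Zp = (y / x)^-1 Zq]. *)
have -> : (x * y)%:E * \int[P']_x (t x)%:E =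
    \int[nu]_z ((y / x * f z)%:E * K (EFin \o t) z).
  rewrite (_ : x * y = y / x * Zp)%R; last by rewrite -xE; field; rewrite gt_eqF.
  rewrite EFinM -muleA hP// (density_integral hf)//; last 2 first.
  - exact: measurable_kap.
  - by move=> z; exact: kap_ge0.
  rewrite -ge0_integralZl//; last 3 first.
  - by apply: emeasurable_funM; [exact/measurable_EFinP|exact: measurable_kap].
  - by move=> z _; rewrite mule_ge0 ?kap_ge0// lee_fin.
  - by rewrite lee_fin divr_ge0// ltW.
  by apply: eq_integral => z _; rewrite muleA.
have -> : (x * y)%:E * \int[Q']_x (t' x)%:E =
    \int[nu]_z (((y / x)^-1 * g z)%:E * K (EFin \o t') z).
  rewrite (_ : x * y = (y / x)^-1 * Zq)%R; last by rewrite -yE; field; rewrite !gt_eqF.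
  rewrite EFinM -muleA hQ// (density_integral hg)//; last 2 first.
  - exact: measurable_kap.
  - by move=> z; exact: kap_ge0.
  rewrite -ge0_integralZl//; last 3 first.
  - by apply: emeasurable_funM; [exact/measurable_EFinP|exact: measurable_kap].
  - by move=> z _; rewrite mule_ge0 ?kap_ge0// lee_fin.
  - by rewrite lee_fin invr_ge0 divr_ge0// ltW.
  by apply: eq_integral => z _; rewrite muleA.
have yx : (0 < y / x)%R by rewrite divr_gt0.
have q1 z : 0 <= (y / x * f z)%:E * K (EFin \o t) z.
  by rewrite mule_ge0 ?kap_ge0// lee_fin mulr_ge0// ltW.
have q2 z : 0 <= ((y / x)^-1 * g z)%:E * K (EFin \o t') z.
  by rewrite mule_ge0 ?kap_ge0// lee_fin mulr_ge0// invr_ge0 ltW.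
have n1 : measurable_fun setT (fun z => (y / x * f z)%:E * K (EFin \o t) z).
  apply: emeasurable_funM; last exact: measurable_kap.
  by apply/measurable_EFinP; exact: measurable_funM.
have n2 : measurable_fun setT (fun z => ((y / x)^-1 * g z)%:E * K (EFin \o t') z).
  apply: emeasurable_funM; last exact: measurable_kap.
  by apply/measurable_EFinP; exact: measurable_funM.
rewrite -ge0_integralD//; apply: ge0_le_integral => //.
- by move=> z _; rewrite mule_ge0 ?kap_ge0// lee_fin !mulr_ge0 ?sqrtr_ge0.
- apply: emeasurable_funM; last exact: measurable_kap.
  by apply/measurable_EFinP; apply: measurable_funM => //;
     apply: measurable_funM; exact: measurable_sqrt.
- exact: emeasurable_funD.
- by move=> z _; exact: kap_am_gm.
Qed.

(** Write [f + g = (sqrt f - sqrt g)^2 + 2 sqrt (f g)] inside [Zp + Zq]. The square contributes at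
    most [2 c d_H(P,Q)^2], the product is bounded by the affinity of the posteriors, and completing
    the square in the evidences isolates [Zp d_H(P',Q')^2]. *)
Lemma dH_post_half P Q Zp Zq P' Q' : is_post lam Phi G P Zp P' -> is_post lam Phi G Q Zq Q' ->
  d_H P' Q' <= (2 * Num.sqrt c / Num.sqrt Zp)%:E * d_H P Q.
Proof.
move=> hP hQ; have Zp0 := hP.1; have Zq0 := hQ.1.
have [nu [f [g [_ [hf hg _]]]]] := exists_common_density P Q Q.
have [nu' [p [q [_ [hp hq _]]]]] := exists_common_density P' Q' Q'.
have [mf f0 _] := hf; have [mg g0 _] := hg.
rewrite (dH_eq hf hg) (dH_eq hp hq) -EFinM lee_fin.
have := affinity_post hP hQ hf hg hp hq.
have [a [aE /andP[_ a1] Ia]] := affinity_real hf hg.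
have [b [bE b01 _]] := affinity_real hp hq.
rewrite aE bE /= -!EFinM.
set x := Num.sqrt Zp; set y := Num.sqrt Zq => hb.
have x0 : (0 < x)%R by rewrite sqrtr_gt0.
have y0 : (0 < y)%R by rewrite sqrtr_gt0.
have xE : (x ^+ 2 = Zp)%R by rewrite sqr_sqrtr// ltW.
have yE : (y ^+ 2 = Zq)%R by rewrite sqr_sqrtr// ltW.
have mk : measurable_fun setT (K (cst 1)) by exact: measurable_kap.
have k0 z : 0 <= K (cst 1) z by exact: kap_ge0.
have msq : measurable_fun setT (fun z => ((Num.sqrt (f z) - Num.sqrt (g z)) ^+ 2)%:E).
  exact: measurable_sqr_sqrt_sub.
have sq0 z : 0 <= ((Num.sqrt (f z) - Num.sqrt (g z)) ^+ 2)%:E.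
  by rewrite lee_fin sqr_ge0.
have maf : measurable_fun setT (fun z => (2 * (Num.sqrt (f z) * Num.sqrt (g z)))%:E).
  by apply/measurable_EFinP; apply: measurable_funM => //;
     apply: measurable_funM; exact: measurable_sqrt.
have af0 z : 0 <= (2 * (Num.sqrt (f z) * Num.sqrt (g z)))%:E.
  by rewrite lee_fin !mulr_ge0 ?sqrtr_ge0.
have h1 : \int[nu]_z (((Num.sqrt (f z) - Num.sqrt (g z)) ^+ 2)%:E * K (cst 1) z) <=
    (c * (2 * (1 - a)))%:E.
  rewrite EFinM -Ia -ge0_integralZl//; apply: ge0_le_integral => //.
  - by move=> z _; rewrite mule_ge0.
  - exact: emeasurable_funM.
  - exact: emeasurable_funM.
  - by move=> z _; rewrite muleC lee_wpmul2r.
have h2 : (Zp + Zq)%:E <= (c * (2 * (1 - a)) + x * y * (2 * b))%:E.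
  rewrite EFinD (is_post_mass hP) (is_post_mass hQ).
  rewrite (density_integral hf)// (density_integral hg)//.
  have mfk : measurable_fun setT (fun z => (f z)%:E * K (cst 1) z).
    by apply: emeasurable_funM => //; exact/measurable_EFinP.
  have mgk : measurable_fun setT (fun z => (g z)%:E * K (cst 1) z).
    by apply: emeasurable_funM => //; exact/measurable_EFinP.
  rewrite -ge0_integralD//; last 2 first.
  - by move=> z _; rewrite mule_ge0 ?lee_fin.
  - by move=> z _; rewrite mule_ge0 ?lee_fin.
  rewrite EFinD; apply: le_trans (leeD h1 hb).
  rewrite -ge0_integralD//; last 4 first.
  - by move=> z _; rewrite mule_ge0.
  - exact: emeasurable_funM.
  - by move=> z _; rewrite mule_ge0.
  - exact: emeasurable_funM.
  rewrite le_eqVlt; apply/orP; left; apply/eqP; apply: eq_integral => z _.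
  rewrite -ge0_muleDl ?lee_fin// -ge0_muleDl//; congr (_ * _).
  by rewrite -!EFinD; congr EFin; rewrite sqrrB !sqr_sqrtr//; ring.
rewrite lee_fin in h2.
have h3 : (x ^+ 2 * (1 - b) <= c * (2 * (1 - a)))%R.
  by apply: (sqrt_affinity_bound x0 y0 b01); rewrite xE yE; lra.
have [b0 b1] := andP b01.
have -> : (2 * Num.sqrt c / x * Num.sqrt (1 - a) = Num.sqrt (4 * c / x ^+ 2 * (1 - a)))%R.
  rewrite sqrtrM; last by rewrite divr_ge0 ?sqr_ge0// mulr_ge0.
  rewrite sqrtrM ?mulr_ge0// sqrtrM// sqrtrV ?sqr_ge0// sqrtr_sqr gtr0_norm//.
  by rewrite (_ : 4 = 2 ^+ 2 :> R)%R ?sqrtr_sqr ?ger0_norm// expr2 -natrM.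
apply: ler_wsqrtr; rewrite mulrAC ler_pdivlMr ?exprn_gt0// mulrC.
(* The argument yields the factor 2 under the root; the stated constant allows 4. *)
apply: le_trans h3 _; have : (0 <= c * (1 - a))%R by rewrite mulr_ge0// subr_ge0.
by lra.
Qed.

Lemma dH_post P Q Zp Zq P' Q' N : is_post lam Phi G P Zp P' -> is_post lam Phi G Q Zq Q' ->
  N = Zp \/ N = Zq -> d_H P' Q' <= (2 * Num.sqrt c / Num.sqrt N)%:E * d_H P Q.
Proof.
move=> hP hQ [->|->]; first exact: dH_post_half hP hQ.
by rewrite dH_sym (dH_sym P); exact: dH_post_half hQ hP.
Qed.

End HellingerKernel.

(** * Wasserstein distance *)

Section MetricMeasurability.
Context {R : realType} {d : measure_display} {T : measurableType d}.
Variable dist : T -> T -> R.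
Hypothesis pol : polish dist.

Let dist0 x y : (0 <= dist x y)%R. Proof. by have [[]] := pol. Qed.
Let dist_sym x y : dist x y = dist y x. Proof. by have [[]] := pol. Qed.
Let dist_tri x y z : (dist x z <= dist x y + dist y z)%R.
Proof. by have [[]] := pol. Qed.

Lemma measurable_dball x r : measurable (dball dist x r).
Proof.
have [_ _ _ ->] := pol; apply: sub_sigma_algebra => y /= xy.
exists (r - dist x y)%R; first by rewrite subr_gt0.
by move=> z /= yz; apply: le_lt_trans (dist_tri x y z) _; rewrite addrC -ltrBrDr.
Qed.

Lemma measurable_of_rays d' (T' : measurableType d') (f : T' -> R) :
  (forall r, measurable [set x | (f x < r)%R]) -> measurable_fun setT f.
Proof.
move=> h; apply: (measurability (@RGenInftyO.G R)) => [|/= _ [_ [r ->] <-]].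
  exact: RGenInftyO.measurableE.
rewrite setTI (_ : _ @^-1` _ = [set x | (f x < r)%R])//.
Qed.

Lemma measurable_dist_to a : measurable_fun setT (fun x => dist x a).
Proof.
apply: measurable_of_rays => r.
rewrite (_ : [set x | _] = dball dist a r); first exact: measurable_dball.
by apply/seteqP; split => x; rewrite /dball/= dist_sym.
Qed.

(** Measurability is for the product sigma-algebra, which is where separability enters:
    [dist x y < r] if and only if [dist x s + dist y s < r] for some [s] in the dense sequence. *)
Lemma measurable_dist : measurable_fun setT (fun z : T * T => dist z.1 z.2).
Proof.
have [_ [s hs] _ _] := pol; apply: measurable_of_rays => r.
rewrite (_ : [set x | _] =
    \bigcup_n [set z : T * T | (dist z.1 (s n) + dist z.2 (s n) < r)%R]).
  apply: bigcupT_measurable => n.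
  have m : measurable_fun setT (fun z : T * T => (dist z.1 (s n) + dist z.2 (s n)))%R.
    by apply: measurable_funD; apply: (measurableT_comp (measurable_dist_to (s n))).
  rewrite (_ : [set z | _] =
     (fun z : T * T => (dist z.1 (s n) + dist z.2 (s n))%R) @^-1` `]-oo, r[).
    by rewrite -[X in measurable X]setTI; exact: m.
  by apply/seteqP; split => z /=; rewrite in_itv.
apply/seteqP; split => [[x y] /= xyr|[x y] [n _] /= h].
  have e0 : (0 < (r - dist x y) / 2)%R by rewrite divr_gt0// subr_gt0.
  have [n hn] := hs y _ e0; exists n => //=.
  by have := dist_tri x y (s n); lra.
by apply: le_lt_trans h; rewrite [dist y _]dist_sym; exact: dist_tri.
Qed.

(** [N x] is the first index of a point of the dense sequence within [e] of [x], so the cells are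
    balls minus earlier balls. *)
Lemma exists_cells (e : R) : (0 < e)%R -> exists N : T -> nat,
  measurable_fun setT N /\ forall x y, N x = N y -> (dist x y < 2 * e)%R.
Proof.
move=> e0; have [_ [s hs] _ _] := pol.
have ex x : exists n, (dist x (s n) < e)%R by exact: hs.
pose N x := ex_minn (ex x).
have NP x : (dist x (s (N x)) < e)%R by rewrite /N; case: ex_minnP.
have Nmin x n : (dist x (s n) < e)%R -> (N x <= n)%N.
  by rewrite /N; case: ex_minnP => m _ h /h.
exists N; split; last first.
  move=> x y xy; have := dist_tri x (s (N x)) y; have := NP x; have := NP y.
  by rewrite -xy [dist (s _) y]dist_sym; lra.
move=> _ Y _; rewrite setTI.
pose B n := [set x | (dist x (s n) < e)%R].
have mB n : measurable (B n).
  rewrite (_ : B n = dball dist (s n) e); first exact: measurable_dball.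
  by apply/seteqP; split => x; rewrite /dball/B/= dist_sym.
have -> : N @^-1` Y = \bigcup_(n in Y) (B n `\` \big[setU/set0]_(m < n) B m).
  apply/seteqP; split => [x /= Yx|x [n Yn] [/= xn]].
    exists (N x) => //; split; first exact: NP.
    by rewrite -(bigcup_mkord _ B) => -[m /= mN /Nmin]; rewrite leqNgt mN.
  rewrite -(bigcup_mkord _ B) => h; suff -> : N x = n by [].
  apply/eqP; rewrite eqn_leq Nmin//= leqNgt; apply/negP => Nn.
  by apply: h; exists (N x) => //; exact: NP.
apply: bigcup_measurable => n _; apply: measurableD => //.
by apply: bigsetU_measurable.
Qed.

End MetricMeasurability.

Section Coupling.
Context {R : realType} {d : measure_display} {T : measurableType d}.
Implicit Types P Q S : probability T R.

Lemma coupling_integral1 P Q (pi : {measure set (T * T) -> \bar R}) phi :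
  coupling P Q pi -> measurable_fun setT phi -> (forall x, 0 <= phi x) ->
  \int[pi]_z phi z.1 = \int[P]_x phi x.
Proof.
move=> c mphi phi0.
rewrite -(@eqm_integral R _ _ (pushforward pi fst)); last first.
  move=> A mA; have [<- _] := c A mA; rewrite /pushforward; congr (pi _).
  by apply/seteqP; split => [[x y]|[x y] []].
by rewrite (ge0_integral_pushforward measurable_fst pi measurableT).
Qed.

Lemma coupling_integral2 P Q (pi : {measure set (T * T) -> \bar R}) phi :
  coupling P Q pi -> measurable_fun setT phi -> (forall x, 0 <= phi x) ->
  \int[pi]_z phi z.2 = \int[Q]_x phi x.
Proof.
move=> c mphi phi0.
rewrite -(@eqm_integral R _ _ (pushforward pi snd)); last first.
  move=> A mA; have [_ <-] := c A mA; rewrite /pushforward; congr (pi _).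
  by apply/seteqP; split => [[x y]|[x y] []].
by rewrite (ge0_integral_pushforward measurable_snd pi measurableT).
Qed.

Lemma couplingP P Q (pi : {measure set (T * T) -> \bar R}) :
  (forall A, measurable A -> \int[pi]_z (\1_A z.1)%:E = P A) ->
  (forall A, measurable A -> \int[pi]_z (\1_A z.2)%:E = Q A) ->
  coupling P Q pi.
Proof.
move=> h1 h2 A mA; split.
  rewrite -h1// integral_indicE; last exact: measurableX.
  apply: eq_integral => -[x y] _; congr EFin; rewrite !indicE; congr (nat_of_bool _)%:R.
  by apply/idP/idP; rewrite !inE /=; [case|].
rewrite -h2// integral_indicE; last exact: measurableX.
apply: eq_integral => -[x y] _; congr EFin; rewrite !indicE; congr (nat_of_bool _)%:R.
by apply/idP/idP; rewrite !inE /=; [case|].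
Qed.

(** Total mass 1 follows from the marginals, so couplings may be built as bare measures. *)
Lemma dW1_le_coupling (dist : T -> T -> R) P Q (pi : {measure set (T * T) -> \bar R}) :
  coupling P Q pi -> d_W1 dist P Q <= \int[pi]_z (dist z.1 z.2)%:E.
Proof.
move=> c; have pi1 : pi setT = 1.
  by have [h _] := c setT measurableT; rewrite -setXTT h probability_setT.
have [p hp] := exists_probability pi1.
rewrite (eqm_integral _ _ hp); apply: ereal_inf_lbound; exists p => //= A mA.
by rewrite -!hp; [exact: c|exact: measurableX|exact: measurableX].
Qed.

End Coupling.

Lemma ereal_inf_add_ge (R : realType) (A B : set (\bar R)) (x : \bar R) :
  (forall a, A a -> 0 <= a) -> (forall b, B b -> 0 <= b) ->
  (forall a b, A a -> B b -> x <= a + b) -> x <= ereal_inf A + ereal_inf B.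
Proof.
move=> A0 B0 h.
have iA0 : 0 <= ereal_inf A by apply: le_ereal_inf_tmp => a /A0.
have iB0 : 0 <= ereal_inf B by apply: le_ereal_inf_tmp => a /B0.
have [Afin|] := boolP (ereal_inf A \is a fin_num); last first.
  rewrite ge0_fin_numE// ltey negbK => /eqP->.
  by rewrite addye ?leey// gt_eqF// (lt_le_trans _ iB0).
have [Bfin|] := boolP (ereal_inf B \is a fin_num); last first.
  rewrite ge0_fin_numE// ltey negbK => /eqP->.
  by rewrite addey ?leey// gt_eqF// (lt_le_trans _ iA0).
apply/lee_addgt0Pr => e e0; have e2 : (0 < e / 2)%R by rewrite divr_gt0.
have [a Aa ha] := lb_ereal_inf_adherent e2 Afin.
have [b Bb hb] := lb_ereal_inf_adherent e2 Bfin.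
apply: (le_trans (h _ _ Aa Bb)); apply: (le_trans (leeD (ltW ha) (ltW hb))).
by rewrite addeACA -EFinD -splitr.
Qed.

(** * Approximate gluing of couplings and the triangle inequality *)

Section Gluing.
Context {R : realType} {d : measure_display} {T : measurableType d}.
Variables (P S Q : probability T R) (N : T -> nat).
Hypothesis mN : measurable_fun setT N.
Variables pi1 pi2 : probability (T * T)%type R.
Hypothesis c1 : coupling P S pi1.
Hypothesis c2 : coupling S Q pi2.

Let cell n := N @^-1` [set n].
Let mcell n : measurable (cell n).
Proof. by rewrite -[X in measurable X]setTI; exact: mN. Qed.
Let sz n : R := fine (S (cell n)).
Let szE n : S (cell n) = (sz n)%:E.
Proof. by rewrite /sz fineK// fin_num_measure. Qed.
Let sz0 n : (0 <= sz n)%R. Proof. by rewrite -lee_fin -szE measure_ge0. Qed.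

(** On a cell of mass zero the quotient is 0 by convention, and the glued measure ignores that cell;
    [live] marks the cells that remain. *)
Let dens0 (n m : nat) : R := ((n == m)%:R / sz n)%R.
Let live (n : nat) : R := ((sz n != 0)%:R)%R.

Let mnatfun d' (T' : measurableType d') (f : nat -> T') : measurable_fun setT f.
Proof. by []. Qed.

Let cell_mass n : \int[S]_x (dens0 n (N x))%:E = (live n)%:E.
Proof.
rewrite (eq_integral (fun x => ((sz n)^-1)%:E * (\1_(cell n) x)%:E)); last first.
  move=> x _; rewrite -EFinM /dens0 mulrC; congr (_ * _)%:E.
  by rewrite indicE /cell; congr (nat_of_bool _)%:R; apply/idP/idP => [/eqP ->|];
    rewrite inE //= => ->.
rewrite ge0_integralZl//; last 2 first.
- exact: measurable_indicE.
- by rewrite lee_fin invr_ge0.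
rewrite -(_ : S (cell n) = \int[S]_x (\1_(cell n) x)%:E); last exact: integral_indicE.
rewrite szE -EFinM /live; congr EFin.
by have [->|n0] := eqVneq (sz n) 0%R; rewrite ?mulr0// mulVf.
Qed.

(** Lets the same density be normalised from the side of [s] or of [s'], so that both marginals come
    out right. *)
Let dens0_sym n m : dens0 n m = dens0 m n.
Proof. by rewrite /dens0 eq_sym; have [->|_] := eqVneq m n; rewrite ?mul0r. Qed.

Let dead_null : S [set x | live (N x) != 1%R] = 0.
Proof.
pose F n := if live n != 1%R then cell n else set0.
have mF n : measurable (F n) by rewrite /F; case: ifP.
have -> : [set x | live (N x) != 1%R] = \bigcup_n F n.
  apply/seteqP; split => [x /= h|x [n _]]; first by exists (N x); rewrite // /F h.
  by rewrite /F; case: ifPn => //= h; rewrite /cell /= => ->.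
apply/eqP; rewrite eq_le measure_ge0 andbT.
have mU : measurable (\bigcup_n F n) by exact: bigcupT_measurable.
apply: (le_trans (@measure_sigma_subadditive _ _ _ S _ _ mF mU (@subset_refl _ _))).
rewrite eseries0// => n _ _; rewrite /F; case: ifPn => [|_]; last exact: measure0.
move=> h; transitivity (sz n)%:E; first exact: szE.
by move: h; rewrite /live; have [->|] := eqVneq (sz n) 0%R; rewrite //= eqxx.
Qed.

Let mlive (f : T * T -> T) : measurable_fun setT f ->
  measurable_fun setT (fun z => (live (N (f z)))%:E).
Proof.
move=> mf; apply/measurable_EFinP.
apply: (measurableT_comp (mnatfun live)); exact: measurableT_comp.
Qed.

(** Countably many null cells form a null set of the middle marginal [S], so the factor [live] is
    almost everywhere 1. *)
Let integral_live (pi : probability (T * T)%type R) (pr : T * T -> T) h :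
  measurable_fun setT pr ->
  (forall A, measurable A -> pi (pr @^-1` A) = S A) ->
  measurable_fun setT h -> (forall z, 0 <= h z) ->
  \int[pi]_z (h z * (live (N (pr z)))%:E) = \int[pi]_z h z.
Proof.
move=> mpr marg mh h0; apply: ge0_ae_eq_integral => //.
- by apply: emeasurable_funM => //; exact: mlive.
- by move=> z _; rewrite mule_ge0// lee_fin.
have mD : measurable [set x | live (N x) != 1%R].
  rewrite (_ : [set x | _] = N @^-1` [set n | live n != 1%R])//.
  by rewrite -[X in measurable X]setTI; exact: mN.
exists (pr @^-1` [set x | live (N x) != 1%R]); split.
- by rewrite -[X in measurable X]setTI; exact: mpr.
- exact: etrans (marg _ mD) dead_null.
- move=> z /= hz; apply/negP => /eqP e; apply: hz => _.
  by rewrite e mule1.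
Qed.

(* For w = ((x, s), (s', y)) distributed as pi1 x pi2, this reweighting forces
   s and s' into the same cell. *)
Definition glue_density (w : (T * T) * (T * T)) : R := dens0 (N w.1.2) (N w.2.1).

Lemma glue_density_ge0 w : (0 <= glue_density w)%R.
Proof. by rewrite /glue_density /dens0 divr_ge0. Qed.

Lemma measurable_glue_density : measurable_fun setT glue_density.
Proof.
have m1 : measurable_fun setT (fun w : (T * T) * (T * T) => N w.1.2).
  apply: (measurableT_comp mN); exact: measurableT_comp.
have m2 : measurable_fun setT (fun w : (T * T) * (T * T) => N w.2.1).
  apply: (measurableT_comp mN); exact: measurableT_comp.
apply: measurable_funM; last first.
  exact: (measurableT_comp (mnatfun (fun n => (sz n)^-1)%R) m1).
have mb : measurable_fun setT (fun b : bool => (b%:R : R)) by [].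
exact: (measurableT_comp mb (measurable_fun_eqn m1 m2)).
Qed.

(** For a fixed first pair, the density depends on the second pair only through a point of law [S];
    integrating it out leaves [live]. *)
Lemma glue_integral1 h : measurable_fun setT h -> (forall z, 0 <= h z) ->
  \int[pi1 \x pi2]_w ((glue_density w)%:E * h w.1) = \int[pi1]_z h z.
Proof.
move=> mh h0; rewrite fubini_tonelli1//; last 2 first.
- apply: emeasurable_funM; first by apply/measurable_EFinP; exact: measurable_glue_density.
  exact: measurableT_comp.
- by move=> w; rewrite mule_ge0// lee_fin glue_density_ge0.
rewrite -(@integral_live pi1 snd h)//; last first.
  move=> A mA; have [_ <-] := c1 mA; congr (pi1 _).
  by apply/seteqP; split => [[x y]|[x y] []].
apply: eq_integral => z _; rewrite /fubini_F /=.
have md : measurable_fun setT (fun x => (dens0 (N z.2) (N x))%:E).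
  apply/measurable_EFinP; exact: (measurableT_comp (mnatfun (dens0 (N z.2))) mN).
have d0 x : 0 <= (dens0 (N z.2) (N x))%:E by rewrite lee_fin /dens0 divr_ge0.
have md2 : measurable_fun setT (fun w : T * T => (dens0 (N z.2) (N w.1))%:E).
  exact: (measurableT_comp md measurable_fst).
transitivity (h z * \int[pi2]_w (dens0 (N z.2) (N w.1))%:E).
  by rewrite -ge0_integralZl//; apply: eq_integral => w _; rewrite muleC.
by rewrite (coupling_integral1 c2 md d0) cell_mass.
Qed.

Lemma glue_integral2 h : measurable_fun setT h -> (forall z, 0 <= h z) ->
  \int[pi1 \x pi2]_w ((glue_density w)%:E * h w.2) = \int[pi2]_z h z.
Proof.
move=> mh h0; rewrite fubini_tonelli2//; last 2 first.
- apply: emeasurable_funM; first by apply/measurable_EFinP; exact: measurable_glue_density.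
  exact: measurableT_comp.
- by move=> w; rewrite mule_ge0// lee_fin glue_density_ge0.
rewrite -(@integral_live pi2 fst h)//; last first.
  move=> A mA; have [<- _] := c2 mA; congr (pi2 _).
  by apply/seteqP; split => [[x y]|[x y] []].
apply: eq_integral => z _; rewrite /fubini_G /=.
have md : measurable_fun setT (fun x => (dens0 (N z.1) (N x))%:E).
  apply/measurable_EFinP; exact: (measurableT_comp (mnatfun (dens0 (N z.1))) mN).
have d0 x : 0 <= (dens0 (N z.1) (N x))%:E by rewrite lee_fin /dens0 divr_ge0.
have md2 : measurable_fun setT (fun w : T * T => (dens0 (N z.1) (N w.2))%:E).
  exact: (measurableT_comp md measurable_snd).
transitivity (h z * \int[pi1]_w (dens0 (N z.1) (N w.2))%:E).
  rewrite -ge0_integralZl//; apply: eq_integral => w _.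
  by rewrite muleC /glue_density dens0_sym.
by rewrite (coupling_integral2 c1 md d0) cell_mass.
Qed.

Variables (dist : T -> T -> R) (e : R).
Hypothesis dist0 : forall x y, (0 <= dist x y)%R.
Hypothesis dist_tri : forall x y z, (dist x z <= dist x y + dist y z)%R.
Hypothesis mdist : measurable_fun setT (fun z : T * T => dist z.1 z.2).
Hypothesis Ne : forall x y, N x = N y -> (dist x y <= e)%R.
Hypothesis e0 : (0 <= e)%R.

(** The reweighted [pi1 \x pi2] is projected to [(x, y)]. The path from [x] to [y] runs through [s]
    and [s'], and the jump between them stays in one cell. *)
Lemma dW1_glue : d_W1 dist P Q <=
  \int[pi1]_z (dist z.1 z.2)%:E + \int[pi2]_z (dist z.1 z.2)%:E + e%:E.
Proof.
have mpsi : measurable_fun setT (fun w : (T * T) * (T * T) => (w.1.1, w.2.2)).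
  have m1 : measurable_fun setT (fun w : (T * T) * (T * T) => w.1.1).
    exact: measurableT_comp.
  have m2 : measurable_fun setT (fun w : (T * T) * (T * T) => w.2.2).
    exact: measurableT_comp.
  exact: measurable_fun_pair m1 m2.
have [mu muE] := exists_image_measure (pi1 \x pi2) measurable_glue_density
   glue_density_ge0 mpsi.
have c : coupling P Q mu.
  apply: couplingP => A mA; have mi := measurable_indicE (R := R) mA;
    have i0 x : 0 <= (\1_A x : R)%:E by rewrite lee_fin.
  - rewrite muE//; last exact: (measurableT_comp mi).
    rewrite (@glue_integral1 (fun z => (\1_A z.1)%:E))//; last exact: (measurableT_comp mi).
    by rewrite (coupling_integral1 c1 mi i0) -integral_indicE.
  - rewrite muE//; last exact: (measurableT_comp mi).
    rewrite (@glue_integral2 (fun z => (\1_A z.2)%:E))//; last exact: (measurableT_comp mi).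
    by rewrite (coupling_integral2 c2 mi i0) -integral_indicE.
apply: (le_trans (dW1_le_coupling _ c)).
have mEd : measurable_fun setT (fun z : T * T => (dist z.1 z.2)%:E) by exact/measurable_EFinP.
rewrite muE//; last by move=> z; rewrite lee_fin.
have mg : measurable_fun setT (fun w => (glue_density w)%:E).
  by apply/measurable_EFinP; exact: measurable_glue_density.
have g0 w : 0 <= (glue_density w)%:E by rewrite lee_fin glue_density_ge0.
have -> : e%:E = \int[pi1 \x pi2]_w ((glue_density w)%:E * e%:E).
  rewrite (@glue_integral1 (fun=> e%:E))//.
  rewrite integral_cst// -[LHS]mule1; congr (_ * _).
  exact/esym/(probability_setT pi1).
rewrite -(glue_integral1 mEd); last by move=> z; rewrite lee_fin.
rewrite -(glue_integral2 mEd); last by move=> z; rewrite lee_fin.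
have n1 : measurable_fun setT (fun w : (T * T) * (T * T) =>
    (glue_density w)%:E * (dist w.1.1 w.1.2)%:E).
  by apply: emeasurable_funM => //; exact: (measurableT_comp mEd).
have n2 : measurable_fun setT (fun w : (T * T) * (T * T) =>
    (glue_density w)%:E * (dist w.2.1 w.2.2)%:E).
  by apply: emeasurable_funM => //; exact: (measurableT_comp mEd).
have n3 : measurable_fun setT (fun w : (T * T) * (T * T) =>
    (glue_density w)%:E * e%:E).
  exact: emeasurable_funM.
rewrite -ge0_integralD//; last 2 first.
- by move=> w _; rewrite mule_ge0// lee_fin.
- by move=> w _; rewrite mule_ge0// lee_fin.
rewrite -ge0_integralD//; last 3 first.
- by move=> w _; rewrite adde_ge0// mule_ge0// lee_fin.
- exact: emeasurable_funD.
- by move=> w _; rewrite mule_ge0// lee_fin.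
apply: ge0_le_integral => //.
- by move=> w _; rewrite mule_ge0// lee_fin.
- by apply: emeasurable_funM => //; exact: (measurableT_comp mEd mpsi).
- by apply: emeasurable_funD => //; exact: emeasurable_funD.
move=> [[x s] [s' y]] _ /=.
suff : (glue_density ((x, s), (s', y)) * dist x y <=
  glue_density ((x, s), (s', y)) * dist x s +
  glue_density ((x, s), (s', y)) * dist s' y +
  glue_density ((x, s), (s', y)) * e)%R by rewrite -lee_fin; apply.
rewrite -!mulrDr.
have := glue_density_ge0 ((x, s), (s', y)); rewrite /glue_density /dens0 /=.
have [E|_ _] := eqVneq (N s) (N s'); last by rewrite !mul0r.
move=> g1; apply: ler_wpM2l => //.
by have := dist_tri x s y; have := dist_tri s s' y; have := Ne E; lra.
Qed.

End Gluing.

Lemma dW1_triangle (R : realType) d (T : measurableType d) (dist : T -> T -> R)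
    (P S Q : probability T R) : polish dist ->
  d_W1 dist P Q <= d_W1 dist P S + d_W1 dist S Q.
Proof.
move=> pol; have [[dist0 _ dist_sym dist_tri] _ _ _] := pol.
apply: ereal_inf_add_ge.
- by move=> _ [pi _ <-]; apply: integral_ge0 => z _; rewrite lee_fin.
- by move=> _ [pi _ <-]; apply: integral_ge0 => z _; rewrite lee_fin.
move=> _ _ [pi1 c1 <-] [pi2 c2 <-]; apply/lee_addgt0Pr => e e0.
have e2 : (0 < e / 2)%R by rewrite divr_gt0.
have [N [mN hN]] := exists_cells pol e2.
apply: (dW1_glue mN c1 c2) => //.
- exact: measurable_dist.
- by move=> x y /hN; rewrite mulrC divfK// => /ltW.
- exact: ltW.
Qed.

Section ProductCoupling.
Context {R : realType} {d : measure_display} {T : measurableType d}.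

Lemma product_coupling (P Q : probability T R) : coupling P Q (P \x Q).
Proof.
move=> A mA; rewrite !product_measure1E//.
split; [rewrite -[RHS]mule1 | rewrite -[RHS]mul1e]; congr (_ * _);
  exact: probability_setT.
Qed.

Lemma le_mul_dW1 (dist : T -> T -> R) (P Q : probability T R) (x : \bar R) (K : R) :
  (0 <= K)%R ->
  (forall pi : probability (T * T)%type R, coupling P Q pi ->
     x <= K%:E * \int[pi]_z (dist z.1 z.2)%:E) ->
  x <= K%:E * d_W1 dist P Q.
Proof.
rewrite le_eqVlt => /predU1P[<- h|K0 h].
  (* [K = 0] cannot be divided out; that some coupling exists already gives [x <= 0]. *)
  by have := h _ (product_coupling P Q); rewrite !mul0e.
rewrite -lee_pdivrMl//; apply: le_ereal_inf_tmp => _ [pi c <-].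
by rewrite lee_pdivrMl//; exact: h.
Qed.

End ProductCoupling.

Section Normalization.
Context {R : realType} {d d' : measure_display}
  {O : measurableType d'} {T : measurableType d}.

Lemma exists_normalized_image (nu : {measure set O -> \bar R}) (b : O -> R)
    (psi : O -> T) (r : R) (P0 : probability T R) :
  measurable_fun setT b -> (forall w, 0 <= b w)%R -> measurable_fun setT psi ->
  \int[nu]_w (b w)%:E = r%:E ->
  exists P : probability T R, forall A, measurable A ->
    r%:E * P A = \int[nu]_w ((b w)%:E * (\1_A (psi w))%:E).
Proof.
move=> mb b0 mpsi br.
have : (0 <= r)%R by rewrite -lee_fin -br; apply: integral_ge0 => w _; rewrite lee_fin.
rewrite le_eqVlt => /predU1P[r0|r0].
  (* With total mass zero both sides vanish, and any probability will do. *)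
  exists P0 => A mA; rewrite -r0 mul0e; apply/esym/eqP; rewrite eq_le.
  apply/andP; split; last by apply: integral_ge0 => w _; rewrite mule_ge0 ?lee_fin.
  rewrite [leRHS](_ : _ = \int[nu]_w (b w)%:E); last by rewrite br -r0.
  apply: ge0_le_integral => //.
  - by move=> w _; rewrite mule_ge0 ?lee_fin.
  - apply: emeasurable_funM; first exact/measurable_EFinP.
    exact: (measurableT_comp (measurable_indicE mA)).
  - exact/measurable_EFinP.
  - by move=> w _; rewrite -EFinM lee_fin ler_piMr// indicE lern1 leq_b1.
have mbr : measurable_fun setT (fun w => b w / r)%R by exact: measurable_funM.
have br0 w : (0 <= b w / r)%R by rewrite divr_ge0// ltW.
have [mu muE] := exists_image_measure nu mbr br0 mpsi.
have mu1 : mu setT = 1.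
  rewrite integral_indicE// muE//; last exact: measurable_indicE.
  under eq_integral => w _ do rewrite indicT mule1 mulrC EFinM.
  rewrite ge0_integralZl//; last 3 first.
  - exact/measurable_EFinP.
  - by move=> w _; rewrite lee_fin.
  - by rewrite lee_fin invr_ge0 ltW.
  by rewrite br -EFinM mulVf// gt_eqF.
have [P hP] := exists_probability mu1.
exists P => A mA; rewrite -hP// integral_indicE// muE//; last first.
  exact: measurable_indicE.
rewrite -ge0_integralZl//; last 3 first.
- apply: emeasurable_funM; first exact/measurable_EFinP.
  exact: (measurableT_comp (measurable_indicE mA)).
- by move=> w _; rewrite mule_ge0 ?lee_fin.
- by rewrite lee_fin ltW.
by apply: eq_integral => w _; rewrite muleA -EFinM [(r * _)%R]mulrC divfK ?gt_eqF.
Qed.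

End Normalization.

(** * The one-step bound in Wasserstein distance *)

Section WassersteinKernel.
Context {R : realType} {d d' : measure_display}
  {T : measurableType d} {U : measurableType d'}.
Variables (lam : {sigma_finite_measure set U -> \bar R}).
Variables (Phi : U * T -> T) (G : U * T -> R).
Hypothesis mPhi : measurable_fun setT Phi.
Hypothesis mG : measurable_fun setT G.
Hypothesis G0 : forall w, (0 <= G w)%R.
Variables (dist : T -> T -> R) (c D L : R).
Hypothesis dist0 : forall x y, (0 <= dist x y)%R.
Hypothesis mdist : measurable_fun setT (fun z : T * T => dist z.1 z.2).
Hypothesis distD : forall x y, (dist x y <= D)%R.
Hypothesis c0 : (0 <= c)%R.
Hypothesis D0 : (0 <= D)%R.
Hypothesis L0 : (0 <= L)%R.
Hypothesis costG : forall z z',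
  \int[lam]_u (G (u, z) * dist (Phi (u, z)) (Phi (u, z')))%:E <= (c * dist z z')%:E.
Hypothesis lipG : forall z z',
  \int[lam]_u (`|G (u, z) - G (u, z')|)%:E <= (L * dist z z')%:E.

Variables (P Q P' Q' : probability T R) (Zp Zq : R).
Hypothesis hP : is_post lam Phi G P Zp P'.
Hypothesis hQ : is_post lam Phi G Q Zq Q'.
Variable pi : probability (T * T)%type R.
Hypothesis cpi : coupling P Q pi.

Let M := Num.max Zp Zq.
Let Zp0 : (0 < Zp)%R. Proof. exact: hP.1. Qed.
Let Zq0 : (0 < Zq)%R. Proof. exact: hQ.1. Qed.
Let M0 : (0 < M)%R. Proof. by rewrite lt_max Zp0. Qed.
Let O := (U * (T * T))%type.
Let Lam := lam \x pi.
Let pr1 (w : O) : U * T := (w.1, w.2.1).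
Let pr2 (w : O) : U * T := (w.1, w.2.2).
(* The common part of the two updates; dividing by the larger evidence keeps it
   below both posteriors, with remainders [b1] and [b2] of equal mass. *)
Let a (w : O) : R := (Num.min (G (pr1 w)) (G (pr2 w)) / M)%R.
Let b1 (w : O) : R := (G (pr1 w) / Zp - a w)%R.
Let b2 (w : O) : R := (G (pr2 w) / Zq - a w)%R.
Let psi (w : O) : T * T := (Phi (pr1 w), Phi (pr2 w)).

Let mpr1 : measurable_fun setT pr1.
Proof.
have m1 : measurable_fun setT (fun w : O => w.2.1) by exact: measurableT_comp.
exact: measurable_fun_pair measurable_fst m1.
Qed.
Let mpr2 : measurable_fun setT pr2.
Proof.
have m1 : measurable_fun setT (fun w : O => w.2.2) by exact: measurableT_comp.
exact: measurable_fun_pair measurable_fst m1.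
Qed.
Let mG1 : measurable_fun setT (G \o pr1). Proof. exact: measurableT_comp. Qed.
Let mG2 : measurable_fun setT (G \o pr2). Proof. exact: measurableT_comp. Qed.
Let mPhi1 : measurable_fun setT (Phi \o pr1). Proof. exact: measurableT_comp. Qed.
Let mPhi2 : measurable_fun setT (Phi \o pr2). Proof. exact: measurableT_comp. Qed.
Let ma : measurable_fun setT a.
Proof. by apply: measurable_funM => //; apply: measurable_minr. Qed.
Let mb1 : measurable_fun setT b1.
Proof. by apply: measurable_funB => //; apply: measurable_funM. Qed.
Let mb2 : measurable_fun setT b2.
Proof. by apply: measurable_funB => //; apply: measurable_funM. Qed.
Let mpsi : measurable_fun setT psi.
Proof. exact: measurable_fun_pair mPhi1 mPhi2. Qed.

Let a0 w : (0 <= a w)%R.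
Proof. by rewrite /a divr_ge0 ?(ltW M0)// le_min !G0. Qed.
Let div_M_le N x : (0 < N)%R -> (N <= M)%R -> (0 <= x)%R -> (x / M <= x / N)%R.
Proof. by move=> N0 NM x0; rewrite ler_wpM2l// lef_pV2. Qed.
Let b10 w : (0 <= b1 w)%R.
Proof.
rewrite subr_ge0; apply: le_trans (div_M_le Zp0 _ (G0 _)).
  by rewrite /a ler_wpM2r ?invr_ge0 ?(ltW M0)// ge_min lexx.
by rewrite le_max lexx.
Qed.
Let b20 w : (0 <= b2 w)%R.
Proof.
rewrite subr_ge0; apply: le_trans (div_M_le Zq0 _ (G0 _)).
  by rewrite /a ler_wpM2r ?invr_ge0 ?(ltW M0)// ge_min lexx orbT.
by rewrite le_max lexx orbT.
Qed.

(** The marginal of [pi] along [pj] is [S], so [G (pr w) / Z] as a density on [lam \x pi] represents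
    [S']; it is then split as [a + b]. Written once for both projections. *)
Let post_split_gen (pr : O -> U * T) (pj : T * T -> T) (S S' : probability T R)
    (Z : R) (b : O -> R) phi :
  (forall w, pr w = (w.1, pj w.2)) -> is_post lam Phi G S Z S' ->
  measurable_fun setT pr -> measurable_fun setT b -> (forall w, 0 <= b w)%R ->
  (forall w, b w = G (pr w) / Z - a w)%R ->
  (forall g, measurable_fun setT g -> (forall x, 0 <= g x) ->
     \int[pi]_z g (pj z) = \int[S]_x g x) ->
  measurable_fun setT phi -> (forall x, 0 <= phi x) ->
  \int[S']_x phi x = \int[Lam]_w ((a w)%:E * phi (Phi (pr w))) +
     \int[Lam]_w ((b w)%:E * phi (Phi (pr w))).
Proof.
move=> prE [Z0 hS] mpr mb b0 bE marg mphi phi0.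
have mphiPhi : measurable_fun setT (fun w => phi (Phi (pr w))).
  by apply: (measurableT_comp mphi); exact: measurableT_comp.
rewrite -ge0_integralD//; last 4 first.
- by move=> w _; rewrite mule_ge0 ?lee_fin.
- by apply: emeasurable_funM => //; exact/measurable_EFinP.
- by move=> w _; rewrite mule_ge0 ?lee_fin.
- by apply: emeasurable_funM => //; exact/measurable_EFinP.
have mGphi : measurable_fun setT (fun w => (G (pr w))%:E * phi (Phi (pr w))).
  by apply: emeasurable_funM => //; apply/measurable_EFinP; exact: measurableT_comp.
transitivity (Z^-1%:E * \int[Lam]_w ((G (pr w))%:E * phi (Phi (pr w)))); last first.
  rewrite -ge0_integralZl//; last 2 first.
  - by move=> w _; rewrite mule_ge0 ?lee_fin.
  - by rewrite lee_fin invr_ge0 ltW.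
  apply: eq_integral => w _; rewrite -ge0_muleDl ?lee_fin// muleA -EFinM -EFinD.
  by rewrite bE; congr (_%:E * _); ring.
rewrite fubini_tonelli2//; last by move=> w; rewrite mule_ge0 ?lee_fin.
transitivity (Z^-1%:E * \int[pi]_z kap lam Phi G phi (pj z)); last first.
  congr (_ * _); apply: eq_integral => z _; rewrite /fubini_G /kap.
  by apply: eq_integral => u _; rewrite prE.
rewrite marg; last 2 first.
- exact: measurable_kap.
- by move=> z; exact: kap_ge0.
by rewrite -hS// muleA -EFinM mulVf ?gt_eqF// mul1e.
Qed.

Let post_split1 phi : measurable_fun setT phi -> (forall x, 0 <= phi x) ->
  \int[P']_x phi x = \int[Lam]_w ((a w)%:E * phi (Phi (pr1 w))) +
     \int[Lam]_w ((b1 w)%:E * phi (Phi (pr1 w))).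
Proof.
apply: (@post_split_gen pr1 fst P P' Zp) => // g mg g0.
exact: coupling_integral1 cpi mg g0.
Qed.

Let post_split2 phi : measurable_fun setT phi -> (forall x, 0 <= phi x) ->
  \int[Q']_x phi x = \int[Lam]_w ((a w)%:E * phi (Phi (pr2 w))) +
     \int[Lam]_w ((b2 w)%:E * phi (Phi (pr2 w))).
Proof.
apply: (@post_split_gen pr2 snd Q Q' Zq) => // g mg g0.
exact: coupling_integral2 cpi mg g0.
Qed.

(** Both posteriors have mass 1 and share the part [a], so what remains is finite and equal. *)
Let masses : exists r : R, [/\ (0 <= r)%R,
  \int[Lam]_w (b1 w)%:E = r%:E & \int[Lam]_w (b2 w)%:E = r%:E].
Proof.
have E (f : O -> R) (g : O -> T) :
    \int[Lam]_w ((f w)%:E * (cst 1 : T -> \bar R) (g w)) = \int[Lam]_w (f w)%:E.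
  by apply: eq_integral => w _; rewrite mule1.
have one (S : probability T R) : \int[S]_x (cst 1 : T -> \bar R) x = 1.
  by rewrite integral_cst// mul1e; exact: probability_setT.
have := @post_split1 (cst 1) (measurable_cst _) (fun=> lee01).
have := @post_split2 (cst 1) (measurable_cst _) (fun=> lee01).
rewrite !E !one.
have : 0 <= \int[Lam]_w (a w)%:E by apply: integral_ge0 => w _; rewrite lee_fin.
have : 0 <= \int[Lam]_w (b1 w)%:E by apply: integral_ge0 => w _; rewrite lee_fin.
have : 0 <= \int[Lam]_w (b2 w)%:E by apply: integral_ge0 => w _; rewrite lee_fin.
case: (integral _ _ (fun w => (b2 w)%:E)) => [y| |]//;
case: (integral _ _ (fun w => (b1 w)%:E)) => [x| |]//;
case: (integral _ _ (fun w => (a w)%:E)) => [t| |]//.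
rewrite !lee_fin -!EFinD => y0 x0 t0 [E1] [E2]; exists x; split=> //.
by congr EFin; lra.
Qed.

(** Only the remainder on the side of the larger evidence is a positive part of a difference of
    values of [G], divided by [M]. As the masses agree, estimating that one is enough. *)
Let residual_le r : \int[Lam]_w (b1 w)%:E = r%:E -> \int[Lam]_w (b2 w)%:E = r%:E ->
  r%:E <= (L / M)%:E * \int[pi]_z (dist z.1 z.2)%:E.
Proof.
move=> r1 r2.
have mabs : measurable_fun setT (fun w => (M^-1 * `|G (pr1 w) - G (pr2 w)|)%:E).
  apply/measurable_EFinP; apply: measurable_funM => //; apply: measurableT_comp => //.
  exact: measurable_funB.
have abs0 w : 0 <= (M^-1 * `|G (pr1 w) - G (pr2 w)|)%:E.
  by rewrite lee_fin mulr_ge0// invr_ge0 ltW.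
have h : r%:E <= \int[Lam]_w (M^-1 * `|G (pr1 w) - G (pr2 w)|)%:E.
  have [MZ|MZ] : M = Zp \/ M = Zq by rewrite /M; case: leP => _; [right|left].
  - rewrite -r1; apply: ge0_le_integral => //.
    + by move=> w _; rewrite lee_fin.
    + exact/measurable_EFinP.
    + move=> w _; rewrite lee_fin /b1 /a -MZ -mulrBl mulrC ler_wpM2l ?invr_ge0 ?(ltW M0)//.
      have [h|h] := leP (G (pr1 w)) (G (pr2 w)); first by rewrite subrr.
      exact: ler_norm.
  - rewrite -r2; apply: ge0_le_integral => //.
    + by move=> w _; rewrite lee_fin.
    + exact/measurable_EFinP.
    + move=> w _; rewrite lee_fin /b2 /a -MZ -mulrBl mulrC ler_wpM2l ?invr_ge0 ?(ltW M0)//.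
      have [h|h] := leP (G (pr1 w)) (G (pr2 w)); last by rewrite subrr.
      by rewrite distrC; exact: ler_norm.
apply: (le_trans h); rewrite fubini_tonelli2//.
have mEd : measurable_fun setT (fun z : T * T => (dist z.1 z.2)%:E) by exact/measurable_EFinP.
rewrite -ge0_integralZl//; last 2 first.
- by move=> z _; rewrite lee_fin.
- by rewrite lee_fin divr_ge0// ltW.
apply: ge0_le_integral => //.
- by move=> z _; apply: integral_ge0 => u _.
- by apply: measurable_fun_fubini_tonelli_G.
- exact: emeasurable_funM.
move=> z _; rewrite /fubini_G /=.
under eq_integral do rewrite EFinM.
rewrite ge0_integralZl//; last 2 first.
- apply/measurable_EFinP; apply: measurableT_comp => //.
  by apply: measurable_funB; apply: (measurableT_comp mG); exact: pair2_measurable.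
- by rewrite lee_fin invr_ge0 ltW.
apply: (le_trans (lee_wpmul2l _ (lipG _ _))); first by rewrite lee_fin invr_ge0 ltW.
by rewrite -!EFinM lee_fin mulrA [(M^-1 * L)%R]mulrC.
Qed.

Let common_cost : \int[Lam]_w ((a w)%:E * (dist (psi w).1 (psi w).2)%:E) <=
  (c / M)%:E * \int[pi]_z (dist z.1 z.2)%:E.
Proof.
have mEd : measurable_fun setT (fun z : T * T => (dist z.1 z.2)%:E) by exact/measurable_EFinP.
have mdpsi : measurable_fun setT (fun w => dist (psi w).1 (psi w).2).
  exact: (measurableT_comp mdist mpsi).
have mf : measurable_fun setT (fun w =>
    (M^-1 * (G (pr1 w) * dist (psi w).1 (psi w).2))%:E).
  by apply/measurable_EFinP; apply: measurable_funM => //; exact: measurable_funM.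
have f0 w : 0 <= (M^-1 * (G (pr1 w) * dist (psi w).1 (psi w).2))%:E.
  by rewrite lee_fin !mulr_ge0// invr_ge0 ltW.
apply: (@le_trans _ _
   (\int[Lam]_w (M^-1 * (G (pr1 w) * dist (psi w).1 (psi w).2))%:E)).
  apply: ge0_le_integral => //.
  - by move=> w _; rewrite mule_ge0 ?lee_fin.
  - by apply: emeasurable_funM; exact/measurable_EFinP.
  - move=> w _; rewrite -EFinM lee_fin mulrA ler_wpM2r// /a mulrC.
    by rewrite ler_wpM2l ?invr_ge0 ?(ltW M0)// ge_min lexx.
rewrite fubini_tonelli2// -ge0_integralZl//; last 2 first.
- by move=> z _; rewrite lee_fin.
- by rewrite lee_fin divr_ge0// ltW.
apply: ge0_le_integral => //.
- by move=> z _; apply: integral_ge0 => u _.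
- by apply: measurable_fun_fubini_tonelli_G.
- exact: emeasurable_funM.
move=> [z z'] _; rewrite /fubini_G /=.
under eq_integral do rewrite EFinM.
rewrite ge0_integralZl//; last 3 first.
- apply/measurable_EFinP; apply: measurable_funM.
    by apply: (measurableT_comp mG); exact: pair2_measurable.
  apply: (measurableT_comp mdpsi (pair2_measurable (z, z'))).
- by move=> u _; rewrite lee_fin mulr_ge0.
- by rewrite lee_fin invr_ge0 ltW.
apply: (le_trans (lee_wpmul2l _ (costG _ _))); first by rewrite lee_fin invr_ge0 ltW.
by rewrite -!EFinM lee_fin mulrA [(M^-1 * c)%R]mulrC.
Qed.

Lemma dW1_post_coupling : d_W1 dist P' Q' <=
  ((c + D * L) / M)%:E * \int[pi]_z (dist z.1 z.2)%:E.
Proof.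
have mEd : measurable_fun setT (fun z : T * T => (dist z.1 z.2)%:E) by exact/measurable_EFinP.
have [r [r0 r1 r2]] := masses.
(* Here [P'] is only the default for a remainder of mass zero. *)
have [p1 hp1] := exists_normalized_image P' mb1 b10 mPhi1 r1.
have [p2 hp2] := exists_normalized_image P' mb2 b20 mPhi2 r2.
have [mu muE] := exists_image_measure Lam ma a0 mpsi.
pose rn : {nonneg R} := NngNum r0.
(* Equal masses of the remainders are what makes [r * (p1 \x p2)] have the two remainders as
   marginals. *)
pose ga : {measure set (T * T) -> \bar R} := measure_add mu (mscale rn (p1 \x p2)).
have gaE g : measurable_fun setT g -> (forall z, 0 <= g z) ->
    \int[ga]_z g z = \int[Lam]_w ((a w)%:E * g (psi w)) + r%:E * \int[p1 \x p2]_z g z.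
  move=> mg g0; rewrite ge0_integral_measure_add// muE//; congr (_ + _).
  by rewrite ge0_integral_mscale.
have cga : coupling P' Q' ga.
  apply: couplingP => A mA; have mi := measurable_indicE (R := R) mA;
    have i0 x : 0 <= (\1_A x : R)%:E by rewrite lee_fin.
  - rewrite gaE//; last exact: (measurableT_comp mi).
    rewrite (coupling_integral1 (product_coupling p1 p2) mi i0) -integral_indicE//.
    by rewrite hp1// [RHS]integral_indicE// (post_split1 mi i0).
  - rewrite gaE//; last exact: (measurableT_comp mi).
    rewrite (coupling_integral2 (product_coupling p1 p2) mi i0) -integral_indicE//.
    by rewrite hp2// [RHS]integral_indicE// (post_split2 mi i0).
apply: (le_trans (dW1_le_coupling _ cga)).
rewrite gaE//; last by move=> z; rewrite lee_fin.
rewrite mulrDl EFinD ge0_muleDl; last 2 first.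
- by rewrite lee_fin divr_ge0// ltW.
- by rewrite lee_fin divr_ge0 ?(ltW M0)// mulr_ge0.
apply: leeD; first exact: common_cost.
apply: (@le_trans _ _ (r%:E * D%:E)).
  apply: lee_wpmul2l; first by rewrite lee_fin.
  apply: (@le_trans _ _ (\int[p1 \x p2]_z D%:E)).
    apply: ge0_le_integral => //.
    - by move=> z _; rewrite lee_fin.
    - by move=> z _; rewrite lee_fin.
  rewrite integral_cst// -[leRHS]mule1 lee_wpmul2l ?lee_fin//.
  exact: probability_le1.
rewrite muleC -mulrA EFinM -muleA lee_wpmul2l ?lee_fin//.
exact: residual_le.
Qed.

End WassersteinKernel.

(** * Chaining the one-step bounds *)

Section DistanceFacts.
Context {R : realType} {d : measure_display} {T : measurableType d}.
Implicit Types (mu nu : set T -> \bar R) (P Q S : probability T R).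
Variables (dist : T -> T -> R) (dk : distance).
Local Notation dd := (dist_of dist dk).

Lemma eqm_sym mu nu : eqm mu nu -> eqm nu mu.
Proof. by move=> h A mA; rewrite h. Qed.

Lemma dist_of_eqm mu nu mu' nu' : eqm mu nu -> eqm mu' nu' -> dd mu mu' = dd nu nu'.
Proof.
move=> e e'; have den la f : is_density la mu f = is_density la nu f.
  by apply/propext; split; apply: eqm_is_density => //; exact: eqm_sym.
have den' la f : is_density la mu' f = is_density la nu' f.
  by apply/propext; split; apply: eqm_is_density => //; exact: eqm_sym.
case: dk => /=.
- rewrite /d_TV; congr ereal_inf; apply/seteqP; split => _ [la [f [g [h1 h2 ->]]]];
  exists la, f, g; split => //; [by rewrite -den|by rewrite -den'|by rewrite den|].
  by rewrite den'.
- rewrite /d_H; congr ereal_inf; apply/seteqP; split => _ [la [f [g [h1 h2 ->]]]];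
  exists la, f, g; split => //; [by rewrite -den|by rewrite -den'|by rewrite den|].
  by rewrite den'.
- rewrite /d_W1; congr ereal_inf; apply/seteqP; split => _ [pi c <-];
  exists pi => // A mA; have [h1 h2] := c A mA; first by rewrite -e// -e'.
  by rewrite e// e'.
Qed.

Lemma dist_of_ge0 P Q : polish dist -> 0 <= dd P Q.
Proof.
move=> [[dist0 _ _ _] _ _ _]; case: dk => /=; [exact: dTV_ge0|exact: dH_ge0|].
apply: le_ereal_inf_tmp => _ [pi _ <-]; apply: integral_ge0 => z _.
by rewrite lee_fin.
Qed.

Lemma dist_of_triangle P S Q : polish dist -> dd P Q <= dd P S + dd S Q.
Proof.
move=> pol; case: dk => /=; [exact: dTV_triangle|exact: dH_triangle|].
exact: dW1_triangle.
Qed.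

End DistanceFacts.

Section Chain.
Context {R : realType} {d : measure_display} {T : measurableType d}.
Implicit Types (mu nu : set T -> \bar R) (P Q S : probability T R).

Definition step_factor (dk : distance) (c N : R) : R :=
  match dk with
  | dHel => 2 * Num.sqrt c / Num.sqrt N
  | _ => c / N
  end.

(** Quantifying over [N] keeps both choices of evidence, so that one chaining argument gives the
    coefficients [C_j] and [C'_j]. *)
Definition stable_step (dist : T -> T -> R) dk (c : R)
    (F : (set T -> \bar R) -> set T -> \bar R) (adm : (set T -> \bar R) -> Prop) :=
  forall mu mu' P Q, eqm mu P -> eqm mu' Q -> adm mu -> adm mu' ->
  [/\ (0 < fine (Zev F mu))%R, (0 < fine (Zev F mu'))%R &
    exists P' Q', [/\ eqm (post F mu) P', eqm (post F mu') Q' &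
      forall N, N = fine (Zev F mu) \/ N = fine (Zev F mu') ->
      dist_of dist dk P' Q' <= (step_factor dk c N)%:E * dist_of dist dk P Q]].

Lemma step_factor_ge0 dk c N : (0 <= c)%R -> (0 <= N)%R -> (0 <= step_factor dk c N)%R.
Proof. by case: dk => /= c0 N0; rewrite divr_ge0// ?mulr_ge0 ?sqrtr_ge0. Qed.

Lemma sqrt_prod (m n : nat) (f : nat -> R) :
  (forall i, (m <= i < n)%N -> 0 <= f i)%R ->
  (Num.sqrt (\prod_(m <= i < n) f i) = \prod_(m <= i < n) Num.sqrt (f i))%R.
Proof.
have [nm _|mn] := leqP n m; first by rewrite !big_geq// sqrtr1.
rewrite -(subnKC (ltnW mn)); elim: (n - m)%N => [|p IH] f0.
  by rewrite addn0 !big_geq// sqrtr1.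
rewrite addnS !big_nat_recr ?leq_addr//= sqrtrM.
  by rewrite IH// => i /andP[mi ip]; apply: f0; rewrite mi addnS ltnS ltnW.
rewrite big_nat_cond; apply: prodr_ge0 => i /andP[/andP[mi ip] _].
by apply: f0; rewrite mi addnS ltnS ltnW.
Qed.

Lemma coef_prod dk (c Z : nat -> R) (j k : nat) :
  (forall i, (j < i <= k)%N -> 0 <= Z i)%R ->
  coef dk c (\prod_(j.+1 <= i < k.+1) Z i) j k =
  (\prod_(j.+1 <= i < k.+1) step_factor dk (c i) (Z i))%R.
Proof.
move=> Z0; case: dk => /=; try by rewrite prodf_div.
rewrite prodf_div big_split /= prodr_const_nat subSS sqrt_prod//.
Qed.

(** A discrete Gronwall inequality: an error made at step [j] is amplified by the factors of the
    later steps only. *)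
Lemma recursive_bound (E De : nat -> \bar R) (a : nat -> R) (k : nat) : (0 < k)%N ->
  (forall n, (1 <= n <= k)%N -> 0 <= De n) -> E 1%N <= De 1%N ->
  (forall n, (1 <= n < k)%N -> (0 <= a n.+1)%R /\ E n.+1 <= (a n.+1)%:E * E n + De n.+1) ->
  E k <= \sum_(1 <= j < k) ((\prod_(j.+1 <= i < k.+1) a i)%:E * De j) + De k.
Proof.
case: k => // k _; elim: k => [|k IH] De0 E1 step.
  by rewrite big_geq// add0e.
have [a0 /le_trans] := step k.+1 (ltnSn _); apply.
rewrite leeD2r// big_nat_recr//=.
have {}IH : E k.+1 <= \sum_(1 <= j < k.+1)
    ((\prod_(j.+1 <= i < k.+2) a i)%:E * De j) + De k.+1.
  apply: IH => // n /andP[n1 nk]; first by apply: De0; rewrite n1 ltnW.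
  by apply: step; rewrite n1 ltnW.
apply: (le_trans (lee_wpmul2l _ IH)); first by rewrite lee_fin.
have p0 j : (1 <= j)%N -> (0 <= \prod_(j.+1 <= i < k.+2) a i)%R.
  move=> j1; rewrite big_nat_cond; apply: prodr_ge0 => -[//|i] /andP[/andP[ji ik] _].
  have i1 : (1 <= i < k.+2)%N by rewrite (leq_trans j1)//= ltnW.
  by have [] := step i i1.
have t0 j : (1 <= j < k.+1)%N -> 0 <= (\prod_(j.+1 <= i < k.+2) a i)%:E * De j.
  move=> /andP[j1 jk]; rewrite mule_ge0 ?lee_fin ?p0//.
  by apply: De0; rewrite j1 (leq_trans (ltnW jk)).
rewrite ge0_muleDr; last 2 first.
- by rewrite big_nat_cond; apply: sume_ge0 => j /andP[/t0].
- by apply: De0; rewrite leqnSn.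
rewrite big_nat1 leeD2r// le_eqVlt; apply/orP; left; apply/eqP.
rewrite [in LHS]big_nat_cond ge0_sume_distrr; last by move=> j /andP[/t0].
rewrite -big_nat_cond; apply: eq_big_nat => j /andP[j1 jk].
rewrite muleA -EFinM mulrC; congr (_%:E * _).
by rewrite [in RHS]big_nat_recr//= ltnW.
Qed.

Variables (dist : T -> T -> R) (dk : distance).
Hypothesis pol : polish dist.
Variables (Ft : nat -> (set T -> \bar R) -> set T -> \bar R)
  (adm : nat -> (set T -> \bar R) -> Prop) (c : nat -> R).
Variables (k : nat) (P0 : probability T R) (Q : nat -> probability T R).
Hypothesis k1 : (1 <= k)%N.
Hypothesis step : forall i, (1 <= i <= k)%N -> stable_step dist dk (c i) (Ft i) (adm i).
Hypothesis c0 : forall i, (1 <= i <= k)%N -> (0 <= c i)%R.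
Hypothesis admP : forall i, (i <= k.-1)%N -> adm i.+1 (exactP Ft P0 i).
Hypothesis admQ : forall i, (1 <= i <= k.-1)%N -> adm i.+1 (Q i).

Let dd := dist_of dist dk.
Let Qm := fun i => Q i : set T -> \bar R.

Let step1 n : (n < k)%N -> stable_step dist dk (c n.+1) (Ft n.+1) (adm n.+1).
Proof. by move=> nk; exact: step. Qed.

Let exactP_prob n : (n <= k)%N -> exists P : probability T R, eqm (exactP Ft P0 n) P.
Proof.
elim: n => [_|n IH nk]; first by exists P0.
have [P hP] := IH (ltnW nk).
have a1 : adm n.+1 (exactP Ft P0 n) by apply: admP; rewrite -ltnS prednK.
by have [_ _ [P' [_ [h _ _]]]] := step1 nk hP hP a1 a1; exists P'.
Qed.

Let Z_gt0 n : (n < k)%N -> (0 < fine (Zev (Ft n.+1) (exactP Ft P0 n)))%R.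
Proof.
move=> nk; have [P hP] := exactP_prob (ltnW nk).
have a1 : adm n.+1 (exactP Ft P0 n) by apply: admP; rewrite -ltnS prednK.
by have [] := step1 nk hP hP a1 a1.
Qed.

Let admQ' n : (1 <= n < k)%N -> adm n.+1 (Q n).
Proof. by move=> /andP[n1 nk]; apply: admQ; rewrite n1 -ltnS prednK. Qed.

Let ZQ_gt0 n : (1 <= n < k)%N -> (0 < fine (Zev (Ft n.+1) (Q n)))%R.
Proof.
move=> nk; have a1 := admQ' nk; have /andP[_ nk'] := nk.
have e : eqm (Q n) (Q n) by [].
by have [] := step1 nk' e e a1 a1.
Qed.

Let Qstar_prob n : (1 <= n <= k)%N -> exists P : probability T R, eqm (Qstar Ft P0 Qm n) P.
Proof.
case: n => // -[|n] nk.
  (* At step 1 the approximate and the exact chain start from the same prior, so [Qstar] is the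
     exact posterior. *)
  by exact: (exactP_prob k1).
have a1 : adm n.+2 (Q n.+1) by apply: admQ'.
have e : eqm (Q n.+1) (Q n.+1) by [].
by have [_ _ [P' [_ [h _ _]]]] := step1 nk e e a1 a1; exists P'.
Qed.

Let bound (N : nat -> R) :
  (forall n, (1 <= n < k)%N -> N n.+1 = fine (Zev (Ft n.+1) (exactP Ft P0 n)) \/
     N n.+1 = fine (Zev (Ft n.+1) (Q n))) ->
  dd (exactP Ft P0 k) (Q k) <=
     \sum_(1 <= j < k) ((\prod_(j.+1 <= i < k.+1) step_factor dk (c i) (N i))%:E *
        dd (Qstar Ft P0 Qm j) (Q j)) + dd (Qstar Ft P0 Qm k) (Q k).
Proof.
(* The initial inequality is an equality, [P_1] being [Q_1^*] by computation. *)
move=> hN; apply: (@recursive_bound (fun n => dd (exactP Ft P0 n) (Q n))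
  (fun n => dd (Qstar Ft P0 Qm n) (Q n)) (fun i => step_factor dk (c i) (N i))) => //.
  move=> n /Qstar_prob[P hP].
  by rewrite /dd (dist_of_eqm _ _ hP (fun _ _ => erefl)) dist_of_ge0.
move=> n nk; have /andP[n1 nk'] := nk; split.
  apply: step_factor_ge0; first exact: c0.
  by have [->|->] := hN n nk; apply: ltW; [exact: Z_gt0|exact: ZQ_gt0].
have [P hP] := exactP_prob (ltnW nk').
have a1 : adm n.+1 (exactP Ft P0 n) by apply: admP; rewrite -ltnS prednK.
have eQ : eqm (Q n) (Q n) by [].
have [_ _ [P' [Q' [hP' hQ' h]]]] := step1 nk' hP eQ a1 (admQ' nk).
have -> : Qstar Ft P0 Qm n.+1 = post (Ft n.+1) (Q n) by case: n n1 {nk nk' hP a1 eQ hP' hQ' h}.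
rewrite /dd (dist_of_eqm _ _ hP' (fun _ _ => erefl)).
rewrite (dist_of_eqm _ _ hQ' (fun _ _ => erefl)) (dist_of_eqm _ _ hP (fun _ _ => erefl)).
apply: (le_trans (dist_of_triangle dk P' Q' (Q n.+1) pol)).
by rewrite leeD2r//; apply: h; exact: hN.
Qed.

Theorem stability_of_steps : stability_bounds Ft dist dk P0 Qm k c.
Proof.
split.
- have := @bound (fun i => fine (Zev (Ft i) (exactP Ft P0 i.-1))) (fun _ _ => or_introl erefl).
  rewrite -/dd; move/le_trans; apply; rewrite leeD2r// le_eqVlt; apply/orP; left.
  apply/eqP/eq_big_nat => j /andP[j1 jk]; congr (_%:E * _).
  rewrite /pred_dens coef_prod// => -[//|i] /andP[ji ik]; apply: ltW; exact: Z_gt0.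
- have := @bound (fun i => fine (Zev (Ft i) (Q i.-1))) (fun _ _ => or_intror erefl).
  rewrite -/dd; move/le_trans; apply; rewrite leeD2r// le_eqVlt; apply/orP; left.
  apply/eqP/eq_big_nat => j /andP[j1 jk]; congr (_%:E * _).
  rewrite /zprod coef_prod// => -[//|i] /andP[ji ik]; apply: ltW; apply: ZQ_gt0.
  by rewrite (leq_trans j1).
Qed.

End Chain.

Section KernelStep.
Context {R : realType} {d d' : measure_display}
  {T : measurableType d} {U : measurableType d'}.
Variables (lam : {sigma_finite_measure set U -> \bar R}).
Variables (Phi : U * T -> T) (G : U * T -> R).
Hypothesis mPhi : measurable_fun setT Phi.
Hypothesis mG : measurable_fun setT G.
Hypothesis G0 : forall w, (0 <= G w)%R.

(** For [W_1], [c'] bounds the cost of transporting the common part, [L] the mass of the remainders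
    per unit of distance, and [D] the cost of moving that mass. *)
Definition kernel_condition (dist : T -> T -> R) (dk : distance) (c : R) :=
  match dk with
  | dW1 => exists c' D L : R,
      [/\ [/\ 0 <= c', 0 <= D & 0 <= L]%R, (c' + D * L <= c)%R,
        (forall x y, dist x y <= D)%R,
        (forall z z', \int[lam]_u (G (u, z) * dist (Phi (u, z)) (Phi (u, z')))%:E
           <= (c' * dist z z')%:E) &
        (forall z z', \int[lam]_u (`|G (u, z) - G (u, z')|)%:E
           <= (L * dist z z')%:E)]
  | _ => forall z, kap lam Phi G (cst 1) z <= c%:E
  end.

Variables (F : (set T -> \bar R) -> set T -> \bar R) (adm : (set T -> \bar R) -> Prop).
Hypothesis admZ : forall mu, adm mu -> 0 < Zev F mu < +oo.
Hypothesis repF : forall mu (P : probability T R), eqm mu P -> adm mu ->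
  forall A, measurable A -> F mu A = \int[P]_z kap lam Phi G (fun x => (\1_A x)%:E) z.

Lemma post_is_post mu (P : probability T R) : eqm mu P -> adm mu ->
  exists P' : probability T R, eqm (post F mu) P' /\
    is_post lam Phi G P (fine (Zev F mu)) P'.
Proof.
move=> e a; have /andP[Z0 Zoo] := admZ a.
have Zfin : Zev F mu \is a fin_num by rewrite ge0_fin_numE// ltW.
have Zp : (0 < fine (Zev F mu))%R by rewrite fine_gt0// Z0.
have E : \int[P]_z kap lam Phi G (cst 1) z = (fine (Zev F mu))%:E.
  rewrite fineK// /Zev (repF e a)//; apply: eq_integral => z _.
  by rewrite /kap; apply: eq_integral => u _; rewrite indicT.
have [P' hP'] := exists_post mPhi mG G0 Zp E.
exists P'; split=> // A mA; rewrite /post (repF e a)// -hP'.2.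
- rewrite -integral_indicE// muleC muleA -EFinM mulVf ?gt_eqF// mul1e//.
- exact: measurable_indicE.
- by move=> x; rewrite lee_fin.
Qed.

Lemma kernel_stable_step (dist : T -> T -> R) dk (c : R) : polish dist ->
  (0 <= c)%R -> kernel_condition dist dk c -> stable_step dist dk c F adm.
Proof.
move=> pol c0 hc mu mu' P Q e e' am am'.
have [P' [hP' pP']] := post_is_post e am.
have [Q' [hQ' pQ']] := post_is_post e' am'.
have Zp := pP'.1; have Zq := pQ'.1; split=> //; exists P', Q'; split=> // N hN.
have N0 : (0 < N)%R by case: hN => ->.
(* The bounds with the larger evidence are weakened to either one. *)
have NM : (N <= Num.max (fine (Zev F mu)) (fine (Zev F mu')))%R.
  by rewrite le_max; case: hN => ->; rewrite lexx ?orbT.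
case: dk hc => /= hc.
- apply: (le_trans (dTV_post mPhi mG G0 c0 hc pP' pQ')).
  rewrite lee_wpmul2r ?dTV_ge0// lee_fin ler_wpM2l// lef_pV2//.
  by rewrite posrE (lt_le_trans N0).
- exact: (dH_post mPhi mG G0 c0 hc pP' pQ' hN).
- have [c' [D [L [[c'0 D0 L0] cc hD cost lip]]]] := hc.
  have [[dist0 _ _ _] _ _ _] := pol.
  apply: le_mul_dW1; first by rewrite divr_ge0// ltW.
  move=> pi cpi; apply: (le_trans (dW1_post_coupling mPhi mG G0 dist0
    (measurable_dist pol) hD c'0 D0 L0 cost lip pP' pQ' cpi)).
  rewrite lee_wpmul2r//; first by apply: integral_ge0 => z _; rewrite lee_fin.
  rewrite lee_fin; apply: ler_pM => //.
  + by rewrite addr_ge0// mulr_ge0.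
  + by rewrite invr_ge0 (le_trans (ltW N0)).
  + by rewrite lef_pV2// posrE (lt_le_trans N0).
Qed.

End KernelStep.

(** * Suprema, Lipschitz constants and their degenerate cases *)

Section Suprema.
Context {R : realType}.

(** An empty family has supremum [-oo], which [fine] sends to 0. *)
Lemma fine_ereal_sup_ge0 (A : set (\bar R)) :
  (forall a, A a -> 0 <= a) -> (0 <= fine (ereal_sup A))%R.
Proof.
move=> A0; have [->|/set0P[a Aa]] := eqVneq A set0; first by rewrite ereal_sup0.
by apply: fine_ge0; apply: (le_trans (A0 _ Aa)); exact: ereal_sup_ubound.
Qed.

Lemma le_fine_ereal_sup (A : set (\bar R)) x : A x -> 0 <= x ->
  ereal_sup A < +oo -> x <= (fine (ereal_sup A))%:E.
Proof.
move=> Ax x0 Aoo; have xA : x <= ereal_sup A by exact: ereal_sup_ubound.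
by rewrite fineK// ge0_fin_numE// (le_trans x0).
Qed.

Definition lip_sup (T : Type) (f : T -> R) (dist : T -> T -> R) : \bar R :=
  ereal_sup [set r | exists x x', x <> x' /\ r = (`|f x - f x'| / dist x x')%:E].

Context {d : measure_display} {T : measurableType d}.
Variable dist : T -> T -> R.
Hypothesis met : is_metric dist.

Lemma metric_refl x : dist x x = 0%R.
Proof. by have [_ h _ _] := met; apply/h. Qed.

Lemma metric_gt0 x y : x <> y -> (0 < dist x y)%R.
Proof.
have [d0 h _ _] := met; move=> xy; rewrite lt_def d0 andbT.
by apply/eqP => /h.
Qed.

Lemma lip_sup_ge0 (f : T -> R) : (0 <= fine (lip_sup f dist))%R.
Proof.
apply: fine_ereal_sup_ge0 => _ [x [y [_ ->]]]; rewrite lee_fin divr_ge0//.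
by have [d0 _ _ _] := met.
Qed.

Lemma le_lip_sup (f : T -> R) x y : x <> y ->
  (`|f x - f y| / dist x y)%:E <= lip_sup f dist.
Proof. by move=> xy; apply: ereal_sup_ubound; exists x, y. Qed.

Lemma lip_sup_bound (f : T -> R) x y : lip_sup f dist < +oo ->
  (`|f x - f y| <= fine (lip_sup f dist) * dist x y)%R.
Proof.
move=> h; have [d0 _ _ _] := met.
have [->|xy] := pselect (x = y); first by rewrite subrr normr0 metric_refl mulr0.
rewrite -ler_pdivrMr ?metric_gt0// -lee_fin.
apply: le_fine_ereal_sup => //; first by exists x, y.
by rewrite lee_fin divr_ge0.
Qed.

Lemma diam_bound x y : diam dist < +oo -> (dist x y <= fine (diam dist))%R.
Proof.
move=> h; rewrite -lee_fin; apply: le_fine_ereal_sup => //.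
  by exists x => //; exists y.
by rewrite lee_fin; have [d0 _ _ _] := met.
Qed.

Lemma diam_ge0 : (0 <= fine (diam dist))%R.
Proof.
apply: fine_ereal_sup_ge0 => _ [x _ [y _ <-]].
by rewrite lee_fin; have [d0 _ _ _] := met.
Qed.

Lemma lip_sup_singleton (f : T -> R) : (forall x y : T, x = y) -> lip_sup f dist = -oo.
Proof.
move=> h; rewrite /lip_sup (_ : [set r | _] = set0) ?ereal_sup0//.
by apply/seteqP; split => // r [x [y [xy _]]]; have := h x y.
Qed.

End Suprema.

Section IntegralLip.
Context {R : realType} {d d' : measure_display}
  {T : measurableType d} {U : measurableType d'}.
Variables (lam : {sigma_finite_measure set U -> \bar R}).
Variable dist : T -> T -> R.
Hypothesis met : is_metric dist.
Variables (G : U * T -> R) (l : U -> \bar R).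
Hypothesis mG : measurable_fun setT G.
Hypothesis Gl : forall u z z', z <> z' -> (`|G (u, z) - G (u, z')| / dist z z')%:E <= l u.

(* [l] is a supremum over an uncountable family and need not be measurable;
   the integral is then a lower integral, which is still monotone. *)
Lemma integral_lip z z' : \int[lam]_u l u < +oo ->
  \int[lam]_u (`|G (u, z) - G (u, z')|)%:E <=
  (fine (\int[lam]_u l u) * dist z z')%:E.
Proof.
have [d0 _ _ _] := met.
move=> loo; have [->|zz] := pselect (z = z').
  rewrite metric_refl// mulr0.
  by rewrite integral0_eq// => u _; rewrite subrr normr0.
have dzz := metric_gt0 met zz.
have f0 u : 0 <= (`|G (u, z) - G (u, z')| / dist z z')%:E.
  by rewrite lee_fin divr_ge0.
have h : \int[lam]_u (`|G (u, z) - G (u, z')| / dist z z')%:E <= \int[lam]_u l u.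
  by apply: lower_integral_le => // u; exact: Gl.
have If0 : 0 <= \int[lam]_u (`|G (u, z) - G (u, z')| / dist z z')%:E.
  by apply: integral_ge0 => u _.
rewrite EFinM fineK; last by rewrite ge0_fin_numE// (le_trans If0).
rewrite muleC; apply: (le_trans _ (lee_wpmul2l _ h)); last by rewrite lee_fin ltW.
rewrite -ge0_integralZl//; last 2 first.
- apply/measurable_EFinP; apply: measurable_funM => //; apply: measurableT_comp => //.
  by apply: measurable_funB; apply: (measurableT_comp mG); exact: pair2_measurable.
- by rewrite lee_fin ltW.
rewrite le_eqVlt; apply/orP; left; apply/eqP; apply: eq_integral => u _.
by rewrite -EFinM mulrC divfK// gt_eqF.
Qed.

Hypothesis degenerate : (forall z z' : T, z = z') ->
  exists2 r : \bar R, r = 0 \/ r = -oo & forall u, l u = r.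

(** Two distinct points force [l] to be nonnegative. On a one-point space [l] is constantly 0 or
    [-oo], its integral is again 0 or [-oo], and [fine] gives 0. *)
Lemma fine_integral_lip_ge0 : (0 <= fine (\int[lam]_u l u))%R.
Proof.
have [[z [z' zz]]|h] := pselect (exists z z' : T, z <> z').
  have [d0 _ _ _] := met.
  apply: fine_ge0; apply: integral_ge0 => u _; apply: le_trans (Gl u zz).
  by rewrite lee_fin divr_ge0.
have [|r r0 lr] := degenerate.
  by move=> z z'; have [//|zz] := pselect (z = z'); exfalso; apply: h; exists z, z'.
rewrite (eq_integral (cst r)); last by move=> u _; rewrite lr.
rewrite integral_cst//; have [->|->] := r0; first by rewrite mul0e.
have := measure_ge0 lam setT; rewrite le_eqVlt => /predU1P[<-|m0].
  by rewrite mule0.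
by rewrite gt0_mulNye.
Qed.

End IntegralLip.

(** * The three problem types *)

Lemma integral_indic_mul {R : realType} {d} {T : measurableType d}
    (mu : {measure set T -> \bar R}) (f : T -> \bar R) A :
  \int[mu]_(x in A) f x = \int[mu]_x (f x * (\1_A x : R)%:E).
Proof. by rewrite integral_mkcond; apply: eq_integral => x _; rewrite epatch_indic. Qed.

Section IPStep.
Context {R : realType} {d : measure_display} {X : measurableType d} {Y : Type}.
Variables (distX : X -> X -> R) (h : Y -> X -> R) (y : nat -> Y).
Hypothesis pol : polish distX.
Hypothesis mh : forall yy, measurable_fun setT (h yy).
Hypothesis h0 : forall yy x, (0 <= h yy x)%R.
Let met : is_metric distX. Proof. by case: pol. Qed.

(** A Dirac mass on the one-point space: integrating over [u] does nothing. *)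
Let lam : {sigma_finite_measure set unit -> \bar R} := \d_tt.
Let Phi (w : unit * X) := w.2.
Let G i (w : unit * X) := h (y i) w.2.

Let lam_cst (r : \bar R) : \int[lam]_u r = r.
Proof.
by rewrite (integral_cst lam)// -[RHS]mule1; congr (_ * _); exact: diracT.
Qed.

Let kapE i g z : kap lam Phi (G i) g z = (h (y i) z)%:E * g z.
Proof. exact: (lam_cst ((h (y i) z)%:E * g z)). Qed.

Lemma C_h_bound i x : C_h h y i < +oo -> (h (y i) x <= fine (C_h h y i))%R.
Proof.
move=> hoo; rewrite -lee_fin.
have Ax : [set (h (y i) x)%:E | x in setT] (h (y i) x)%:E by exists x.
by apply: (le_fine_ereal_sup Ax) => //; rewrite lee_fin.
Qed.

Lemma C_h_ge0 i : (0 <= fine (C_h h y i))%R.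
Proof. by apply: fine_ereal_sup_ge0 => _ [x _ <-]; rewrite lee_fin. Qed.

Lemma IP_const_ge0 dk i : (0 <= IP_const h y distX dk i)%R.
Proof.
case: dk => /=; try exact: C_h_ge0.
rewrite addr_ge0 ?C_h_ge0// !mulr_ge0 ?diam_ge0//; exact: lip_sup_ge0.
Qed.

Lemma IP_stable_step dk i : IP_assum h y distX dk i ->
  stable_step distX dk (IP_const h y distX dk i) (Ft_IP h y i) (adm_IP h y i).
Proof.
move=> ass; apply: (@kernel_stable_step _ _ _ _ _ lam Phi (G i)) => //.
- exact: measurable_snd.
- exact: (measurableT_comp (mh (y i)) measurable_snd).
- by move=> w; exact: h0.
- by move=> mu [-> ->].
- move=> mu P e _ A mA; rewrite /Ft_IP (eqm_integral _ _ e) integral_indic_mul.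
  by apply: eq_integral => x _; rewrite kapE.
- exact: IP_const_ge0.
have hC : C_h h y i < +oo by case: (dk) ass => //= -[].
have kapC z : kap lam Phi (G i) (cst 1) z <= (fine (C_h h y i))%:E.
  by rewrite kapE mule1 lee_fin C_h_bound.
case: dk ass => //= -[_ hL hD].
(* The state does not move, so the common part costs at most the supremum of [h] times the
   distance. *)
exists (fine (C_h h y i)), (fine (diam distX)), (fine (h_Lip h y distX i)).
have L0 : (0 <= fine (h_Lip h y distX i))%R by exact: lip_sup_ge0.
split.
- by split; rewrite ?C_h_ge0 ?diam_ge0.
- have : (0 <= fine (diam distX) * fine (h_Lip h y distX i))%R by rewrite mulr_ge0 ?diam_ge0.
  lra.
- by move=> x x'; exact: diam_bound.
- move=> z z'; rewrite (_ : \int[lam]_u _ = (h (y i) z * distX z z')%:E).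
    by rewrite lee_fin ler_wpM2r ?C_h_bound//; have [] := met.
  exact: (lam_cst (h (y i) z * distX z z')%:E).
- move=> z z'; rewrite (_ : \int[lam]_u _ = (`|h (y i) z - h (y i) z'|)%:E).
    by rewrite lee_fin; exact: lip_sup_bound.
  exact: (lam_cst (`|h (y i) z - h (y i) z'|)%:E).
Qed.

End IPStep.

Section SEStep.
Context {R : realType} {d : measure_display} {X : measurableType d} {Y : Type}.
Variables (distX : X -> X -> R) (lam : {sigma_finite_measure set X -> \bar R}).
Variables (T : nat -> X -> X -> R) (h : nat -> Y -> X -> R) (y : nat -> Y).
Hypothesis pol : polish distX.
Hypothesis mT : forall i, measurable_fun setT (fun z : X * X => T i z.1 z.2).
Hypothesis T0 : forall i x x', (0 <= T i x x')%R.
Hypothesis mh : forall i yy, measurable_fun setT (h i yy).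
Hypothesis h0 : forall i yy x, (0 <= h i yy x)%R.
Let met : is_metric distX. Proof. by case: pol. Qed.

Let Phi (w : X * X) := w.1.
Let G i (w : X * X) := (h i (y i) w.1 * T i w.1 w.2)%R.
Let mPhi : measurable_fun setT Phi. Proof. exact: measurable_fst. Qed.
Let mG i : measurable_fun setT (G i).
Proof. by apply: measurable_funM => //; exact: (measurableT_comp (mh i (y i))). Qed.
Let G0 i w : (0 <= G i w)%R. Proof. by rewrite mulr_ge0. Qed.

Lemma C_Th_ge0 i : (0 <= fine (C_Th lam T h y i))%R.
Proof.
apply: fine_ereal_sup_ge0 => _ [x _ <-]; apply: integral_ge0 => u _.
exact: (G0 i (u, x)).
Qed.

Let T_LipE i xi : T_Lip T distX i xi = lip_sup (T i xi) distX. Proof. by []. Qed.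

(** For fixed [u] the observation density is a constant factor. *)
Let Gl i u z z' : z <> z' -> (`|G i (u, z) - G i (u, z')| / distX z z')%:E <=
  (h i (y i) u)%:E * T_Lip T distX i u.
Proof.
move=> zz; rewrite /G /= -mulrBr normrM (ger0_norm (h0 _ _ _)) -mulrA EFinM.
by apply: lee_wpmul2l; rewrite ?lee_fin//; exact: le_lip_sup.
Qed.

Lemma Cs_Th_ge0 i : (0 <= fine (Cs_Th lam T h y distX i))%R.
Proof.
apply: (fine_integral_lip_ge0 _ met (@Gl i)) => hX.
have [[u0 _]|X0] := pselect (exists u : X, True); last first.
  by exists 0; [left|move=> u; exfalso; apply: X0; exists u].
exists ((h i (y i) u0)%:E * -oo); last first.
  by move=> u; rewrite T_LipE lip_sup_singleton// (hX u u0).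
(* The product with [-oo] is 0 where [h] vanishes and [-oo] where it is positive, the two values
   allowed for a degenerate bound. *)
have := h0 i (y i) u0; rewrite le_eqVlt => /predU1P[<-|hp]; first by left; rewrite mul0e.
by right; rewrite gt0_muleNy// lte_fin.
Qed.

Lemma SE_const_ge0 dk i : (0 <= SE_const lam T h y distX dk i)%R.
Proof.
case: dk => /=; try exact: C_Th_ge0.
by rewrite !mulr_ge0 ?diam_ge0 ?Cs_Th_ge0.
Qed.

Lemma SE_stable_step dk i : SE_assum lam T h y distX dk i ->
  stable_step distX dk (SE_const lam T h y distX dk i) (Ft_SE lam T h y i)
    (adm_SE lam T h y i).
Proof.
move=> ass; apply: (@kernel_stable_step _ _ _ _ _ lam Phi (G i)) => //.
- by move=> mu [_ -> ->].
- move=> mu P e _ A mA; rewrite /Ft_SE integral_indic_mul.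
  have m1 : measurable_fun setT (fun x => (\1_A x : R)%:E) by exact: measurable_indicE.
  have p1 x : 0 <= (\1_A x : R)%:E by rewrite lee_fin.
  (* The definition integrates the new state outermost, the kernel form the old one. *)
  have := @fubini_tonelli _ _ _ _ _ lam P (fun w => (G i w)%:E * (\1_A (Phi w))%:E)
    (measurable_kap_integrand mPhi (@mG i) m1) (kap_integrand_ge0 Phi (G0 i) p1).
  move=> <-; apply: eq_integral => x _; rewrite (eqm_integral _ _ e).
  have mTx : measurable_fun setT (fun x' => (T i x x')%:E).
    apply/measurable_EFinP.
    exact: (measurableT_comp (mT i) (pair1_measurable x)).
  rewrite -ge0_integralZl ?lee_fin//; last by move=> x' _; rewrite lee_fin.
  rewrite -ge0_integralZr//.
  + exact: emeasurable_funM.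
  + by move=> x' _; rewrite mule_ge0 ?lee_fin.
- exact: SE_const_ge0.
have kapC z : C_Th lam T h y i < +oo -> kap lam Phi (G i) (cst 1) z <=
    (fine (C_Th lam T h y i))%:E.
  move=> hC; rewrite /kap; under eq_integral do rewrite mule1.
  have Ax : [set \int[lam]_x (h i (y i) x * T i x x')%:E | x' in setT]
    (\int[lam]_u (G i (u, z))%:E) by exists z.
  apply: (le_fine_ereal_sup Ax) => //.
  by apply: integral_ge0 => u _; exact: (G0 i (u, z)).
case: dk ass => /= [hC z|hC z|[hT hCs hD]]; try exact: kapC.
(* Both copies share the new state [u], so the common part is transported at no cost. *)
exists 0%R, (fine (diam distX)), (fine (Cs_Th lam T h y distX i)); split.
- by split; rewrite ?diam_ge0 ?Cs_Th_ge0.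
- have : (0 <= fine (diam distX) * fine (Cs_Th lam T h y distX i))%R.
    by rewrite mulr_ge0 ?diam_ge0 ?Cs_Th_ge0.
  lra.
- by move=> x x'; exact: diam_bound.
- move=> z z'; rewrite mul0r integral0_eq// => u _.
  by rewrite metric_refl// mulr0.
- move=> z z'; exact: (integral_lip met (@mG i) (@Gl i) z z' hCs).
Qed.

End SEStep.

(* The library's canonical sigma-finite structure on [m1 \x m2] is shadowed by
   the one of products of subprobabilities, hence this copy. *)
Section ProductSigmaFinite.
Context {R : realType} {d1 d2 : measure_display}
  {T1 : measurableType d1} {T2 : measurableType d2}.
Variables (m1 : {sigma_finite_measure set T1 -> \bar R})
  (m2 : {sigma_finite_measure set T2 -> \bar R}).

Let m := (m1 \x m2)%E.

Let m_sigma_finite : sigma_finite setT m.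
Proof.
have /sigma_finiteP[F [FT ndF Foo]] := sigma_finiteT m1.
have /sigma_finiteP[G [GT ndG Goo]] := sigma_finiteT m2.
exists (fun n => F n `*` G n).
  apply/esym/seteqP; split => // -[x y] _.
  have [n _ Fx] : (\bigcup_n F n) x by rewrite -FT.
  have [p _ Gy] : (\bigcup_n G n) y by rewrite -GT.
  exists (maxn n p) => //; split => /=.
    by move: x Fx; apply/subsetPset/ndF; exact: leq_maxl.
  by move: y Gy; apply/subsetPset/ndG; exact: leq_maxr.
move=> n; have [mF Fn] := Foo n; have [mG Gn] := Goo n; split.
  exact: measurableX.
by rewrite /m product_measure1E// lte_mul_pinfty// ge0_fin_numE.
Qed.

#[local] HB.instance Definition _ := Measure.on m.
#[local] HB.instance Definition _ := Measure_isSigmaFinite.Build _ _ _ m m_sigma_finite.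

Lemma exists_product_density (P : probability (T1 * T2)%type R) :
  (forall A, measurable A -> (m1 \x m2) A = 0 -> P A = 0) ->
  exists f, is_density (m1 \x m2) P f.
Proof. exact: (@exists_density _ _ _ P m). Qed.

End ProductSigmaFinite.

Section PSStep.
Context {R : realType} {dx dw : measure_display}
  {X : measurableType dx} {W : measurableType dw} {Y : Type}.
Variables (dist : X * W -> X * W -> R)
  (lamX : {sigma_finite_measure set X -> \bar R})
  (lamW : {sigma_finite_measure set W -> \bar R}).
Variables (T : nat -> X -> X -> W -> R) (h : nat -> Y -> X -> W -> R) (y : nat -> Y).
Hypothesis pol : polish dist.
Hypothesis mT : forall i,
  measurable_fun setT (fun z : X * X * W => T i z.1.1 z.1.2 z.2).
Hypothesis T0 : forall i x x' w, (0 <= T i x x' w)%R.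
Hypothesis mh : forall i yy, measurable_fun setT (fun z : X * W => h i yy z.1 z.2).
Hypothesis h0 : forall i yy x w, (0 <= h i yy x w)%R.
Let met : is_metric dist. Proof. by case: pol. Qed.

Let Phi (v : X * (X * W)) : X * W := (v.1, v.2.2).
Let G i (v : X * (X * W)) : R := ft T h y i v.1 v.2.
Let m21 : measurable_fun setT (fun v : X * (X * W) => v.2.1).
Proof. exact: measurableT_comp. Qed.
Let m22 : measurable_fun setT (fun v : X * (X * W) => v.2.2).
Proof. exact: measurableT_comp. Qed.
Let mPhi : measurable_fun setT Phi.
Proof. exact: measurable_fun_pair measurable_fst m22. Qed.
Let mG i : measurable_fun setT (G i).
Proof.
apply: measurable_funM; first exact: (measurableT_comp (mh i (y i)) mPhi).
have m : measurable_fun setT (fun v : X * (X * W) => ((v.1, v.2.1), v.2.2)).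
  exact: measurable_fun_pair (measurable_fun_pair measurable_fst m21) m22.
exact: (measurableT_comp (mT i) m).
Qed.
Let G0 i v : (0 <= G i v)%R. Proof. by rewrite mulr_ge0. Qed.

(** Absolute continuity and Radon-Nikodym exclude the default branch of [dens]. *)
Lemma dens_is_density mu (P : probability (X * W)%type R) : eqm mu P ->
  abs_cont lamX lamW mu -> is_density (lamX \x lamW) P (dens lamX lamW mu).
Proof.
move=> e ac; rewrite /dens; case: pselect => [ex|nex].
  exact: eqm_is_density e (svalP (cid ex)).
exfalso; apply: nex.
have [f hf] : exists f, is_density (lamX \x lamW) P f.
  by apply: exists_product_density => A mA A0; rewrite -e//; exact: ac.
by exists f; apply: eqm_is_density hf; exact: eqm_sym.
Qed.

(** Both sides are triple integrals over the new state, the old state and the parameter. The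
    definition has the old state innermost, the kernel form the new one. *)
Lemma Ft_PS_kernel i mu (P : probability (X * W)%type R) A : eqm mu P ->
  abs_cont lamX lamW mu -> measurable A ->
  Ft_PS lamX lamW T h y i mu A =
    \int[P]_z kap lamX Phi (G i) (fun x => (\1_A x)%:E) z.
Proof.
move=> e ac mA; have hd := dens_is_density e ac.
set de := dens lamX lamW mu in hd *; have [mde de0 _] := hd.
have m1 : measurable_fun setT (fun x => (\1_A x : R)%:E) by exact: measurable_indicE.
have p1 x : 0 <= (\1_A x : R)%:E by rewrite lee_fin.
pose F (v : X * (X * W)) := (G i v)%:E * (de v.2)%:E * (\1_A (Phi v))%:E.
have mF : measurable_fun setT F.
  apply: emeasurable_funM; last exact: (measurableT_comp m1 mPhi).
  apply: emeasurable_funM; apply/measurable_EFinP; first exact: mG.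
  exact: (measurableT_comp mde measurable_snd).
have F0 v : 0 <= F v by rewrite /F !mule_ge0 ?lee_fin ?G0.
have msw : measurable_fun setT (fun v : X * (X * W) => (v.2.1, (v.1, v.2.2))).
  exact: measurable_fun_pair m21 mPhi.
have mFsw : measurable_fun setT (fun v : X * (X * W) => F (v.2.1, (v.1, v.2.2))).
  exact: (measurableT_comp mF msw).
have -> : \int[P]_z kap lamX Phi (G i) (fun x => (\1_A x)%:E) z =
    \int[lamX \x lamW]_z \int[lamX]_u F (u, z).
  rewrite (density_integral hd); last 2 first.
  - exact: measurable_kap.
  - by move=> z; apply: kap_ge0 => //; exact: G0.
  apply: eq_integral => z _; rewrite /kap -ge0_integralZl ?lee_fin//; last 2 first.
  - exact: (measurable_section mPhi (@mG i) z m1).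
  - by move=> u _; rewrite mule_ge0 ?lee_fin ?G0.
  by apply: eq_integral => u _; rewrite /F muleA [X in X * _]muleC.
have -> : Ft_PS lamX lamW T h y i mu A =
    \int[lamX \x lamW]_z \int[lamX]_x' F (z.1, (x', z.2)).
  transitivity (\int[lamX \x lamW]_(z in A) ((h i (y i) z.1 z.2)%:E *
      \int[lamX]_x' (T i z.1 x' z.2 * de (x', z.2))%:E)); first by [].
  rewrite integral_indic_mul; apply: eq_integral => -[u w] _ /=.
  have mTd : measurable_fun setT (fun x' => (T i u x' w * de (x', w))%:E).
    apply/measurable_EFinP; apply: measurable_funM.
      have m : measurable_fun setT (fun x' : X => ((u, x'), w)).
        exact: measurable_fun_pair (pair1_measurable u) (measurable_cst _).
      exact: (measurableT_comp (mT i) m).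
    exact: (measurableT_comp mde (pair2_measurable w)).
  rewrite -ge0_integralZl ?lee_fin//; last by move=> x' _; rewrite lee_fin mulr_ge0.
  rewrite -ge0_integralZr ?lee_fin//; last 2 first.
  - exact: emeasurable_funM.
  - by move=> x' _; rewrite mule_ge0 ?lee_fin// mulr_ge0.
  by apply: eq_integral => x' _; rewrite /F /G /ft /= -!EFinM mulrA.
(* The parameter is moved outermost on both sides; for each [w] the two states are then
   exchanged. *)
rewrite fubini_tonelli2; last 2 first.
- exact: (@measurable_fun_fubini_tonelli_G _ _ _ _ _ lamX
    (fun v : X * (X * W) => F (v.2.1, (v.1, v.2.2))) mFsw (fun=> F0 _)).
- by move=> z; exact: integral_ge0.
rewrite fubini_tonelli2; last 2 first.
- exact: (@measurable_fun_fubini_tonelli_G _ _ _ _ _ lamX F mF F0).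
- by move=> z; exact: integral_ge0.
apply: eq_integral => w _.
have mw : measurable_fun setT (fun v : X * X => (v.1, (v.2, w))).
  apply: measurable_fun_pair measurable_fst _.
  exact: measurable_fun_pair measurable_snd (measurable_cst _).
exact: (@fubini_tonelli _ _ _ _ _ lamX lamX (fun v : X * X => F (v.1, (v.2, w)))
  (measurableT_comp mF mw) (fun=> F0 _)).
Qed.

Lemma Ct_Th_ge0 i : (0 <= fine (Ct_Th lamX T h y i))%R.
Proof.
apply: fine_ereal_sup_ge0 => _ [x' [w ->]]; apply: integral_ge0 => u _.
exact: (G0 i (u, (x', w))).
Qed.

Let ft_LipE i u : ft_Lip T h y dist i u = lip_sup (ft T h y i u) dist.
Proof. by []. Qed.

Let Gl i u z z' : z <> z' ->
  (`|G i (u, z) - G i (u, z')| / dist z z')%:E <= ft_Lip T h y dist i u.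
Proof. exact: le_lip_sup. Qed.

Lemma Cts_Th_ge0 i : (0 <= fine (Cts_Th lamX T h y dist i))%R.
Proof.
apply: (fine_integral_lip_ge0 _ met (@Gl i)) => hX.
by exists -oo; [right|move=> u; rewrite ft_LipE lip_sup_singleton].
Qed.

Lemma PS_const_ge0 dk i : (0 <= PS_const lamX T h y dist dk i)%R.
Proof.
case: dk => /=; try exact: Ct_Th_ge0.
by rewrite addr_ge0 ?Ct_Th_ge0// !mulr_ge0 ?diam_ge0 ?Cts_Th_ge0.
Qed.

Lemma PS_stable_step dk i : PS_assum lamX T h y dist dk i ->
  stable_step dist dk (PS_const lamX T h y dist dk i) (Ft_PS lamX lamW T h y i)
    (adm_PS lamX lamW T h y i).
Proof.
move=> ass; apply: (@kernel_stable_step _ _ _ _ _ lamX Phi (G i)) => //.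
- by move=> mu [_ _ -> ->].
- by move=> mu P e [ac _ _ _] A mA; exact: Ft_PS_kernel.
- exact: PS_const_ge0.
have hC : Ct_Th lamX T h y i < +oo by case: (dk) ass => //= -[].
have GC z : \int[lamX]_u (G i (u, z))%:E <= (fine (Ct_Th lamX T h y i))%:E.
  have Ax : [set r | exists x' w,
      r = (\int[lamX]_x (h i (y i) x w * T i x x' w)%:E)]
    (\int[lamX]_u (G i (u, z))%:E) by exists z.1, z.2.
  apply: (le_fine_ereal_sup Ax) => //.
  by apply: integral_ge0 => u _; exact: (G0 i (u, z)).
have kapC z : kap lamX Phi (G i) (cst 1) z <= (fine (Ct_Th lamX T h y i))%:E.
  by rewrite /kap; under eq_integral do rewrite mule1.
case: dk ass => //= -[_ [hL hCs] h3 hD].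
have [dist0 _ _ _] := met.
exists (fine (Ct_Th lamX T h y i)), (fine (diam dist)),
  (fine (Cts_Th lamX T h y dist i)).
split.
- by split; rewrite ?Ct_Th_ge0 ?diam_ge0 ?Cts_Th_ge0.
- have : (0 <= fine (diam dist) * fine (Cts_Th lamX T h y dist i))%R.
    by rewrite mulr_ge0 ?diam_ge0 ?Cts_Th_ge0.
  lra.
- by move=> x x'; exact: diam_bound.
- move=> z z'.
  have mGz : measurable_fun setT (fun u => (G i (u, z))%:E).
    by apply/measurable_EFinP; exact: (measurableT_comp (@mG i) (pair2_measurable z)).
  apply: (@le_trans _ _ (\int[lamX]_u ((G i (u, z))%:E * (dist z z')%:E))).
    apply: lower_integral_le => u; rewrite -?EFinM lee_fin ?mulr_ge0 ?G0//.
    apply: ler_wpM2l; first exact: G0.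
    (* The images [(u, w)] and [(u, w')] share their state, so (PS.3) bounds their distance by that
       of [z] and [z']. *)
    by case: z z' {mGz} => [x w] [x' w']; exact: h3.
  rewrite ge0_integralZr ?lee_fin//; last by move=> u _; rewrite lee_fin G0.
  by rewrite EFinM lee_wpmul2r ?lee_fin.
- move=> z z'; exact: (integral_lip met (@mG i) (@Gl i) z z' hCs).
Qed.

End PSStep.

Local Close Scope ereal_scope.

Theorem theorem2 :
  (* ---------------- inverse problem (IP) ---------------- *)
  (forall (R : realType) (d : measure_display) (X : measurableType d)
     (distX : X -> X -> R) (Y : Type) (h : Y -> X -> R) (y : nat -> Y)
     (k : nat) (P0 : probability X R) (Q : nat -> probability X R)
     (dk : distance),
   polish distX ->
   (forall yy, measurable_fun setT (h yy)) ->
   (forall yy x, 0 <= h yy x) ->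
   (2 <= k)%N ->
   (forall i, (1 <= i <= k)%N -> IP_assum h y distX dk i) ->
   (forall i, (i <= k.-1)%N ->
      adm_IP h y i.+1 (exactP (Ft_IP h y) P0 i)) ->
   (forall i, (1 <= i <= k.-1)%N -> adm_IP h y i.+1 (Q i)) ->
   stability_bounds (Ft_IP h y) distX dk P0 (fun i => Q i : set X -> \bar R) k
     (IP_const h y distX dk)) /\
  (* ---------------- state estimation (SE) ---------------- *)
  (forall (R : realType) (d : measure_display) (X : measurableType d)
     (distX : X -> X -> R) (lam : {sigma_finite_measure set X -> \bar R})
     (Y : Type) (T : nat -> X -> X -> R) (h : nat -> Y -> X -> R) (y : nat -> Y)
     (k : nat) (P0 : probability X R) (Q : nat -> probability X R)
     (dk : distance),
   polish distX ->
   (forall i, measurable_fun setT (fun z : X * X => T i z.1 z.2)) ->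
   (forall i x x', 0 <= T i x x') ->
   (forall i x', (\int[lam]_x (T i x x')%:E)%E = 1%E) ->
   (forall i yy, measurable_fun setT (h i yy)) ->
   (forall i yy x, 0 <= h i yy x) ->
   (2 <= k)%N ->
   (forall i, (1 <= i <= k)%N -> SE_assum lam T h y distX dk i) ->
   (forall i, (i <= k.-1)%N ->
      adm_SE lam T h y i.+1 (exactP (Ft_SE lam T h y) P0 i)) ->
   (forall i, (1 <= i <= k.-1)%N -> adm_SE lam T h y i.+1 (Q i)) ->
   stability_bounds (Ft_SE lam T h y) distX dk P0 (fun i => Q i : set X -> \bar R) k
     (SE_const lam T h y distX dk)) /\
  (* ---------------- parameter-state estimation (PS) ---------------- *)
  (forall (R : realType) (dx dw : measure_display)
     (X : measurableType dx) (W : measurableType dw)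
     (distX : X -> X -> R) (distXW : X * W -> X * W -> R)
     (lamX : {sigma_finite_measure set X -> \bar R})
     (lamW : {sigma_finite_measure set W -> \bar R})
     (Y : Type) (T : nat -> X -> X -> W -> R) (h : nat -> Y -> X -> W -> R)
     (y : nat -> Y) (k : nat)
     (P0 : probability (X * W)%type R) (Q : nat -> probability (X * W)%type R)
     (dk : distance),
   polish distX -> polish distXW ->
   (forall i, measurable_fun setT (fun z : X * X * W => T i z.1.1 z.1.2 z.2)) ->
   (forall i x x' w, 0 <= T i x x' w) ->
   (forall i x' w, (\int[lamX]_x (T i x x' w)%:E)%E = 1%E) ->
   (forall i yy, measurable_fun setT (fun z : X * W => h i yy z.1 z.2)) ->
   (forall i yy x w, 0 <= h i yy x w) ->
   (2 <= k)%N ->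
   (forall i, (1 <= i <= k)%N -> PS_assum lamX T h y distXW dk i) ->
   (forall i, (i <= k.-1)%N ->
      adm_PS lamX lamW T h y i.+1 (exactP (Ft_PS lamX lamW T h y) P0 i)) ->
   (forall i, (1 <= i <= k.-1)%N -> adm_PS lamX lamW T h y i.+1 (Q i)) ->
   stability_bounds (Ft_PS lamX lamW T h y) distXW dk P0
     (fun i => Q i : set (X * W) -> \bar R) k
     (PS_const lamX T h y distXW dk)).
Proof.
split; [|split].
- move=> R d X distX Y h y k P0 Q dk pol mh h0 k2 ass aP aQ.
  apply: (stability_of_steps pol (adm := adm_IP h y)) => //; first exact: ltnW.
    by move=> i ik; apply: IP_stable_step => //; exact: ass.
  by move=> i _; exact: IP_const_ge0.
- move=> R d X distX lam Y T h y k P0 Q dk pol mT T0 _ mh h0 k2 ass aP aQ.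
  apply: (stability_of_steps pol (adm := adm_SE lam T h y)) => //; first exact: ltnW.
    by move=> i ik; apply: SE_stable_step => //; exact: ass.
  by move=> i _; exact: SE_const_ge0.
- move=> R dx dw X W distX distXW lamX lamW Y T h y k P0 Q dk _ pol mT T0 _ mh h0.
  move=> k2 ass aP aQ.
  apply: (stability_of_steps pol (adm := adm_PS lamX lamW T h y)) => //.
  + exact: ltnW.
  + by move=> i ik; apply: PS_stable_step => //; exact: ass.
  + by move=> i _; exact: PS_const_ge0.
Qed.
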